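(* Let $F$ be a box-like self-affine set, the attractor of an IFS $\{S_i\}_{i\in\mathcal I}$ as described in the context, which satisfies the rectangular open set condition (ROSC) and is such that $s_1=s_2=1$, where $s_1=\dim_{\mathrm B}\pi_1(F)$ and $s_2=\dim_{\mathrm B}\pi_2(F)$. Then $$\dim_{\mathrm P}F=\dim_{\mathrm B}F=d,$$ where $d$ is the affinity dimension of the IFS $\{S_i\}_{i\in\mathcal I}$.
   Context: Box-like sets: $\mathcal I$ is a finite index set with $|\mathcal I|\ge 2$, and $\{S_i\}_{i\in\mathcal I}$ is an iterated function system (IFS) of maps $S_i:\mathbb R^2\to\mathbb R^2$ of the form $S_i=T_i\circ L_i+t_i$, where $T_i=\begin{pmatrix}a_i&0\\0&b_i\end{pmatrix}$ with $a_i,b_i\in(0,1)$, $L_i$ is a linear isometry of the plane with $L_i([-1,1]^2)=[-1,1]^2$, and $t_i\in\mathbb R^2$. The box-like self-affine set $F$ is the unique non-empty compact set with $F=\bigcup_{i\in\mathcal I}S_i(F)$. $\pi_1(x,y)=x$ and $\pi_2(x,y)=y$; the box dimensions of $\pi_1(F)$ and $\pi_2(F)$ exist. ROSC: there is a non-empty open rectangle $R=(a,b)\times(c,d)\subset\mathbb R^2$ such that the sets $S_i(R)$, $i\in\mathcal I$, are pairwise disjoint subsets of $R$. Affinity dimension: for a linear map $A:\mathbb R^2\to\mathbb R^2$ with singular values $\alpha_1\ge\alpha_2$, the singular value function is $\phi^0(A)=1$, $\phi^s(A)=\alpha_1^s$ for $0<s\le1$, $\phi^s(A)=\alpha_1\alpha_2^{s-1}$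 for $1<s\le2$, and $\phi^s(A)=(\alpha_1\alpha_2)^{s/2}$ for $s>2$. With $A_i=T_i\circ L_i$ the linear part of $S_i$, $$d=\inf\Big\{s\ge0:\sum_{k=1}^\infty\ \sum_{(i_1,\dots,i_k)\in\mathcal I^k}\phi^s(A_{i_1}\circ\cdots\circ A_{i_k})<\infty\Big\}.$$ $\dim_{\mathrm P}$ is packing dimension and $\dim_{\mathrm B}$ box-counting dimension; an equality involving $\dim_{\mathrm B}F$ includes the assertion that the lower and upper box dimensions of $F$ coincide. *)

(* Defs.v *)
From HB Require Import structures.
From mathcomp Require Import all_boot all_order all_algebra.
From mathcomp Require Import all_classical all_reals all_analysis.

Set Implicit Arguments.
Unset Strict Implicit.
Unset Printing Implicit Defensive.

Import Order.TTheory GRing.Theory Num.Theory.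
Import numFieldNormedType.Exports.

Local Open Scope classical_set_scope.
Local Open Scope ring_scope.
Local Open Scope ereal_scope.

(* Diameters, box dimensions and packing dimension, for a type of points T
   with a real-valued distance. *)
Section dimensions.
Variables (R : realType) (T : Type) (dist : T -> T -> R).
Implicit Types (E B : set T) (x : T) (r s delta : R).

(* The diameter of the empty set is -oo. *)
Definition diam B : \bar R :=
  ereal_sup [set (dist p.1 p.2)%:E | p in B `*` B].

Definition closed_disc x r : set T := [set y | (dist x y <= r)%R].

(* Least number of sets of diameter at most delta that cover E
   (+oo if no finite family does). *)
Definition covering_number E delta : \bar R :=
  ereal_inf [set (n%:R)%:E | n in
    [set n : nat | exists U : 'I_n -> set T,
       (forall i, diam (U i) <= delta%:E) /\ E `<=` \bigcup_i U i]].

Definition box_ratio E delta : \bar R :=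
  lne (covering_number E delta) * ((- ln delta)^-1)%:E.

Definition lower_box_dim E : \bar R := limf_einf (box_ratio E) 0^'+.
Definition upper_box_dim E : \bar R := limf_esup (box_ratio E) 0^'+.

Definition box_dim_is E (x : \bar R) :=
  lower_box_dim E = x /\ upper_box_dim E = x.

(* A countable family, indexed by D, of pairwise disjoint closed balls with
   centres in E and radii at most delta. *)
Definition is_packing E delta (D : set nat) (c : nat -> T)
    (rad : nat -> R) :=
  (forall i, D i -> E (c i) /\ (0 < rad i <= delta)%R) /\
  trivIset D (fun i => closed_disc (c i) (rad i)).

Definition packing_delta s delta E : \bar R :=
  ereal_sup [set y | exists D c rad, is_packing E delta D c rad /\
    y = \esum_(i in D) (diam (closed_disc (c i) (rad i)) `^ s)].

Definition packing_premeasure s E : \bar R :=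
  lim (packing_delta s delta E @[delta --> 0^'+]).

Definition packing_measure s E : \bar R :=
  ereal_inf [set \sum_(0 <= i <oo) packing_premeasure s (Ei i) |
    Ei in [set Ei : nat -> set T | E `<=` \bigcup_i Ei i]].

Definition packing_dim E : \bar R :=
  ereal_inf [set s%:E | s in [set s | (0 <= s)%R /\ packing_measure s E = 0]].

End dimensions.

Local Close Scope ereal_scope.

Section plane.
Variable R : realType.
Implicit Types (u v : 'cV[R]_2) (A : 'M[R]_2).

(* The norm that the library puts on 'cV[R]_2 is the sup norm; it gives the
   topology used by compact, but distances here are Euclidean. *)
Definition euclid v : R := Num.sqrt (\sum_i v i 0 ^+ 2).
Definition euclid_dist u v : R := euclid (u - v).
Definition line_dist (x y : R) : R := `|x - y|.

Definition pi1 v : R := v 0 0.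
Definition pi2 v : R := v 1 0.

(* [-1,1]^2 *)
Definition unit_square : set 'cV[R]_2 := [set v | forall i, `|v i 0| <= 1].

(* (a,b) x (c,d) *)
Definition open_rect (a b c d : R) : set 'cV[R]_2 :=
  [set v | a < pi1 v < b /\ c < pi2 v < d].

(* A^T A has two real eigenvalues counted with multiplicity, hence the largest
   and the smallest one are all of them; singular values are their square
   roots. *)
Definition sing1 A : R :=
  Num.sqrt (sup [set l : R | eigenvalue (A^T *m A) l]).
Definition sing2 A : R :=
  Num.sqrt (inf [set l : R | eigenvalue (A^T *m A) l]).

Definition sv_fun (s : R) A : R :=
  if s == 0 then 1
  else if s <= 1 then sing1 A `^ s
  else if s <= 2 then sing1 A * sing2 A `^ (s - 1)
  else (sing1 A * sing2 A) `^ (s / 2).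

Record boxlike_ifs (I : finType) := BoxlikeIFS {
  bl_a : I -> R;
  bl_b : I -> R;
  bl_L : I -> 'M[R]_2;
  bl_t : I -> 'cV[R]_2;
  bl_aP : forall i, 0 < bl_a i < 1;
  bl_bP : forall i, 0 < bl_b i < 1;
  bl_isometry : forall i v, euclid (bl_L i *m v) = euclid v;
  bl_square : forall i, mulmx (bl_L i) @` unit_square = unit_square
}.

Section ifs.
Variables (I : finType) (S : boxlike_ifs I).

Definition bl_T (i : I) : 'M[R]_2 :=
  diag_mx (\row_(j < 2) [:: bl_a S i; bl_b S i]`_j).

Definition bl_lin (i : I) : 'M[R]_2 := bl_T i *m bl_L S i.

Definition bl_map (i : I) v : 'cV[R]_2 := bl_lin i *m v + bl_t S i.

Definition is_attractor (F : set 'cV[R]_2) :=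
  [/\ F !=set0, compact F & F = \bigcup_i (bl_map i @` F)].

Definition ROSC := exists a b c d : R, [/\ a < b, c < d,
  forall i, bl_map i @` open_rect a b c d `<=` open_rect a b c d &
  trivIset setT (fun i => bl_map i @` open_rect a b c d)].

Definition affinity_dim : \bar R :=
  ereal_inf [set s%:E | s in [set s : R | 0 <= s /\
    (\sum_(1 <= k <oo)
       (\sum_(w : k.-tuple I) sv_fun s (\prod_(i <- w) bl_lin i))%:E
     < +oo)%E]].

End ifs.
End plane.

(* Main.v *)
Require Import Defs.
From HB Require Import structures.
From mathcomp Require Import all_boot all_order all_algebra.
From mathcomp Require Import all_classical all_reals all_analysis.
From mathcomp Require Import ring lra.

(** The linear parts are products of positive diagonal matrices and signed
    permutation matrices, so the cylinder of a word w, the image of F under the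
    corresponding map, lies in an axis-parallel rectangle whose sides are
    proportional to the singular values alpha1 w >= alpha2 w.

    Let N(delta) be the covering number of F. Stop every word as soon as alpha2
    is at most delta; the cylinders of the resulting words cover F, and alpha2
    is comparable to delta for each of them. Such a cylinder can be covered by
    about alpha1 / delta sets. It also needs nearly as many, since its
    projection to the long side is a scaled copy of a projection of F, which
    has dimension 1. By the rectangular open set condition the cylinders lie in
    disjoint rectangles of both sides at least of order delta, so a set of
    diameter delta meets boundedly many of them ([rect_packing_le]) and the
    counts add up ([cover_double_count]). Hence, up to constants and a factor
    delta^-eps,
       N(delta) = sum of alpha1 / delta = delta^-s * (sum of phi^s)
    over the stopped words, where phi^s = alpha1 alpha2^(s-1).

    If the series defining the affinity dimension d converges at s, the last
    sum is bounded and the upper box dimension is at most s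
    ([upper_box_dim_le_affinity]). If s < d, that sum is at least 1: phi^s is
    submultiplicative, so mass below 1 on a single cut of the tree of words
    would force convergence ([summable_of_cut]). So the lower box dimension is
    at least s ([lower_box_dim_ge_affinity]). These arguments need
    1 <= s <= 2. The lower dimension is at least 1 because of the projections
    and the upper one at most 2, and a variant of the lower bound for s > 2
    shows that d <= 2.

    The packing dimension is at most the upper box dimension of F
    ([packing_dim_le]). Conversely, if the s-dimensional packing measure of F
    vanishes, then by the Baire category theorem some set of small premeasure
    is dense in a whole cylinder ([attractor_baire]); its covering numbers are
    at most of order delta^-s, and so are those of F, an affine image of it.
    Thus s is at least the upper box dimension
    ([upper_box_dim_le_of_packing_measure0]). *)

Set Implicit Arguments.
Unset Strict Implicit.
Unset Printing Implicit Defensive.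

Import Order.TTheory GRing.Theory Num.Theory.
Import numFieldNormedType.Exports.

Local Open Scope classical_set_scope.
Local Open Scope ring_scope.

(** * Covers and box dimension *)

Section box_dimension.
Variables (R : realType) (T : Type) (dist : T -> T -> R).
Implicit Types (E B : set T) (r s t c delta : R) (n : nat).

Lemma diam_leP B delta :
  (diam dist B <= delta%:E)%E <->
  (forall x y, B x -> B y -> dist x y <= delta).
Proof.
split=> [/ereal_supP h x y Bx By|h].
  by rewrite -lee_fin; apply: h; exists (x, y).
by apply/ereal_supP => _ [[x y] [/= Bx By] <-]; rewrite lee_fin; exact: h.
Qed.

(** Written with pairwise distances instead of [diam], so that covers can be
    built and used without extended reals. *)
Definition coverable E delta n := exists U : 'I_n -> set T,
  (forall i x y, U i x -> U i y -> dist x y <= delta) /\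
  E `<=` \bigcup_i U i.

Lemma coverableP E delta n : coverable E delta n <->
  exists U : 'I_n -> set T,
    (forall i, diam dist (U i) <= delta%:E)%E /\ E `<=` \bigcup_i U i.
Proof.
split=> -[U [dU EU]]; exists U; split=> // i.
  by apply/diam_leP => x y; exact: dU.
by move=> x y; have /diam_leP := dU i; exact.
Qed.

Lemma covering_number_ge E delta x :
  (forall n, coverable E delta n -> x <= n%:R) ->
  (x%:E <= covering_number dist E delta)%E.
Proof.
move=> h; apply/ereal_infP => _ [n /coverableP En <-].
by rewrite lee_fin; exact: h.
Qed.

Lemma covering_number_le E delta n :
  coverable E delta n -> (covering_number dist E delta <= n%:R%:E)%E.
Proof. by move=> /coverableP h; apply: ereal_inf_lbound; exists n. Qed.

Lemma covering_number_ge0 E delta :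
  (0 <= covering_number dist E delta)%E.
Proof. by apply: covering_number_ge => n _; rewrite ler0n. Qed.

Lemma coverable_of_lt E delta x :
  (covering_number dist E delta < x%:E)%E ->
  exists2 n, coverable E delta n & n%:R < x.
Proof.
move=> /ereal_inf_ltP[_ [n /coverableP En <-]]; rewrite lte_fin => nx.
by exists n.
Qed.

Lemma nbhs_right0 (delta0 : R) : 0 < delta0 ->
  (0 : R)^'+ [set delta | 0 < delta < delta0].
Proof.
move=> d0; near=> d => /=; apply/andP; split.
  by near: d; exact: nbhs_right_gt.
by near: d; exact: nbhs_right_lt.
Unshelve. all: end_near. Qed.

Lemma right0_nbhs (P : set R) : (0 : R)^'+ P ->
  exists2 delta0, 0 < delta0 & forall d, 0 < d < delta0 -> P d.
Proof.
move=> [/= e e0 he]; exists e => // d /andP[d0 de]; apply: he => //=.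
by rewrite /ball_/= sub0r normrN gtr0_norm.
Qed.

(** Multiplicative constants do not matter: they change the ratio by
    ln c / - ln delta, which is below any e > 0 once - ln delta > |ln c| / e.
    The threshold d1 below expresses this. *)
Lemma lower_box_dim_ge E t c delta0 : 0 < c -> 0 < delta0 ->
  (forall delta, 0 < delta < delta0 -> forall n, coverable E delta n ->
     c * delta `^ (- t) <= n%:R) ->
  (t%:E <= lower_box_dim dist E)%E.
Proof.
move=> c0 d0 h; apply/lee_addgt0Pr => e e0.
rewrite -leeBlDr// -EFinB /lower_box_dim limf_einfE.
pose d1 := Num.min delta0 (expR (- (1 + `|ln c| / e))).
apply: le_ereal_sup_tmp.
exists (ereal_inf (box_ratio dist E @` [set d | 0 < d < d1])).
  by exists [set d | 0 < d < d1] => //; apply: nbhs_right0; rewrite lt_min d0 expR_gt0.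
apply/ereal_infP => _ [d /= /andP[dgt0 dd1] <-].
move: dd1; rewrite lt_min => /andP[dd0 de].
have lnd : ln d < - (1 + `|ln c| / e).
  by rewrite -ltr_expR lnK ?posrE.
have q0 : 0 <= `|ln c| / e by rewrite divr_ge0// ltW.
have nd0 : 0 < - ln d by lra.
have dt0 : 0 < c * d `^ (- t) by rewrite mulr_gt0// powR_gt0.
apply: (@le_trans _ _ ((ln (c * d `^ (- t)))%:E * ((- ln d)^-1)%:E)%E).
  rewrite -EFinM lee_fin ler_pdivlMr// lnM ?posrE ?powR_gt0// ln_powR.
  have /ler_normlP[h1 h2] := lexx `|ln c|.
  have : `|ln c| / e * e <= (- ln d) * e by rewrite ler_pM2r//; lra.
  rewrite divfK ?gt_eqF//; nra.
apply: lee_wpmul2r; first by rewrite lee_fin invr_ge0 ltW.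
rewrite -lne_EFin// lee_lne ?in_itv/= ?leey ?andbT ?lee_fin ?(ltW dt0)//.
- apply: covering_number_ge => n; apply: h; first by rewrite dgt0.
- exact: covering_number_ge0.
Qed.

Lemma upper_box_dim_le E t c delta0 : 0 < c -> 0 < delta0 ->
  (forall delta, 0 < delta < delta0 -> exists2 n, coverable E delta n &
     n%:R <= c * delta `^ (- t)) ->
  (upper_box_dim dist E <= t%:E)%E.
Proof.
move=> c0 d0 h; apply/lee_addgt0Pr => e e0.
rewrite -EFinD /upper_box_dim limf_esupE.
pose d1 := Num.min delta0 (expR (- (1 + `|ln c| / e))).
apply: ge_ereal_inf.
exists (ereal_sup (box_ratio dist E @` [set d | 0 < d < d1])).
  by exists [set d | 0 < d < d1] => //; apply: nbhs_right0; rewrite lt_min d0 expR_gt0.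
apply/ereal_supP => _ [d /= /andP[dgt0 dd1] <-].
move: dd1; rewrite lt_min => /andP[dd0 de].
have lnd : ln d < - (1 + `|ln c| / e).
  by rewrite -ltr_expR lnK ?posrE.
have q0 : 0 <= `|ln c| / e by rewrite divr_ge0// ltW.
have nd0 : 0 < - ln d by lra.
have dt0 : 0 < c * d `^ (- t) by rewrite mulr_gt0// powR_gt0.
apply: (@le_trans _ _ ((ln (c * d `^ (- t)))%:E * ((- ln d)^-1)%:E)%E); last first.
  rewrite -EFinM lee_fin ler_pdivrMr// lnM ?posrE ?powR_gt0// ln_powR.
  have /ler_normlP[h1 h2] := lexx `|ln c|.
  have : `|ln c| / e * e <= (- ln d) * e by rewrite ler_pM2r//; lra.
  rewrite divfK ?gt_eqF//; nra.
apply: lee_wpmul2r; first by rewrite lee_fin invr_ge0 ltW.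
rewrite -lne_EFin// lee_lne ?in_itv/= ?leey ?andbT ?lee_fin ?(ltW dt0)
  ?covering_number_ge0//.
have [|n En nle] := h d; first by rewrite dgt0.
by apply: (le_trans (covering_number_le En)); rewrite lee_fin.
Qed.

Lemma lower_box_dim_gt E t : (t%:E < lower_box_dim dist E)%E ->
  exists2 delta0, 0 < delta0 & forall delta, 0 < delta < delta0 ->
    forall n, coverable E delta n -> delta `^ (- t) <= n%:R.
Proof.
rewrite /lower_box_dim limf_einfE => /ereal_sup_gtP[_ [V FV <-] tV].
have [d0 d0gt hV] := right0_nbhs FV.
exists (Num.min d0 1) => [|d]; first by rewrite lt_min d0gt ltr01.
rewrite lt_min => /and3P[dgt dd0 d1] n En.
have : (t%:E <= box_ratio dist E d)%E.
  apply: (le_trans (ltW tV)); apply: ereal_inf_lbound; exists d => //.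
  by apply: hV; rewrite dgt.
have lnd : 0 < - ln d by rewrite oppr_gt0 ln_lt0// dgt.
move=> ht.
have : (t%:E <= lne n%:R%:E * ((- ln d)^-1)%:E)%E.
  apply: (le_trans ht); apply: lee_wpmul2r; first by rewrite lee_fin invr_ge0 ltW.
  rewrite lee_lne ?in_itv/= ?leey ?lee_fin ?ler0n//.
    exact: covering_number_le.
  by rewrite andbT covering_number_ge0.
case: n {En} => [|n].
  rewrite le0_lneNy// mulNyr gtr0_sg ?invr_gt0// mul1e.
  by rewrite leeNy_eq.
rewrite lne_EFin ?ltr0n// -EFinM lee_fin ler_pdivlMr// => ht'.
rewrite -[leRHS]lnK ?posrE ?ltr0n// /powR gt_eqF// ler_expR; lra.
Qed.

Lemma upper_box_dim_lt E t : (upper_box_dim dist E < t%:E)%E ->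
  exists2 delta0, 0 < delta0 & forall delta, 0 < delta < delta0 ->
    exists2 n, coverable E delta n & n%:R <= delta `^ (- t).
Proof.
rewrite /upper_box_dim limf_esupE => /ereal_inf_ltP[_ [V FV <-] tV].
have [d0 d0gt hV] := right0_nbhs FV.
exists (Num.min d0 1) => [|d]; first by rewrite lt_min d0gt ltr01.
rewrite lt_min => /and3P[dgt dd0 d1].
have : (box_ratio dist E d < t%:E)%E.
  apply: (le_lt_trans _ tV); apply: ereal_sup_ubound; exists d => //.
  by apply: hV; rewrite dgt.
have lnd : 0 < - ln d by rewrite oppr_gt0 ln_lt0// dgt.
rewrite /box_ratio => ht.
have : (lne (covering_number dist E d) < (t * - ln d)%:E)%E.
  by move: ht; rewrite muleC -lte_pdivlMl ?invr_gt0// invrK -EFinM mulrC.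
have {1}-> : (t * - ln d)%:E = lne ((d `^ (- t))%:E).
  by rewrite lne_EFin ?powR_gt0// ln_powR mulrN mulNr.
rewrite lte_lne ?in_itv/= ?leey ?lee_fin ?powR_ge0//; last first.
  by rewrite andbT covering_number_ge0.
by move=> /coverable_of_lt[n En nd]; exists n => //; exact: ltW.
Qed.

Lemma lower_le_upper_box_dim E : (lower_box_dim dist E <= upper_box_dim dist E)%E.
Proof.
rewrite /lower_box_dim /upper_box_dim limf_einfE limf_esupE.
apply/ereal_supP => _ [V FV <-]; apply/ereal_infP => _ [W FW <-].
have [d [Vd Wd]] : exists d, V d /\ W d.
  have VW : (0 : R)^'+ (V `&` W) by apply: filterI.
  by have [d0 d0gt hVW] := right0_nbhs VW; exists (d0 / 2); apply: hVW; lra.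
by apply: (@le_trans _ _ (box_ratio dist E d));
  [apply: ereal_inf_lbound|apply: ereal_sup_ubound]; exists d.
Qed.

End box_dimension.

(** * Packing measures and packing dimension *)

Lemma dyadic_level (R : realType) (delta r : R) : 0 < r <= delta ->
  exists k : nat, delta * 2^-1 ^+ k.+1 < r /\ r <= delta * 2^-1 ^+ k.
Proof.
move=> /andP[r0 rd].
have ex : exists k : nat, delta * 2^-1 ^+ k.+1 < r.
  exists (Num.bound (delta / r)).
  rewrite exprVn ltr_pdivrMr ?exprn_gt0// mulrC -ltr_pdivrMr//.
  apply: (@lt_trans _ _ (Num.bound (delta / r))%:R).
    by rewrite archi_boundP// divr_ge0 ?ltW//; apply: lt_le_trans rd.
  move: (Num.bound _) => k; rewrite -natrX ltr_nat.
  by apply: (ltn_trans (ltn_expl k (ltnSn 1))); rewrite ltn_exp2l.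
case: (ex_minnP ex) => k kr kmin; exists k; split=> //.
case: k kr kmin => [|k] kr kmin; first by rewrite expr0 mulr1.
by rewrite leNgt; apply/negP => /kmin; rewrite ltnn.
Qed.

(** The radii are grouped by dyadic level: the hypothesis allows at most
    (delta 2^-(k+1))^-t of them at level k, each contributing at most
    (2 delta 2^-k)^s, and the products form a geometric series of ratio
    2^(t-s) < 1. The bound tends to 0 with delta since s > t. *)
Lemma dyadic_power_sum (R : realType) (r : seq nat) (rad : nat -> R)
    (s t delta : R) : uniq r -> 0 < delta -> t < s -> 0 <= s ->
  (forall i, i \in r -> 0 < rad i <= delta) ->
  (forall eta r', 0 < eta < delta -> uniq r' ->
     {subset r' <= r} -> (forall i, i \in r' -> eta < rad i) ->
     (size r')%:R <= eta `^ (- t)) ->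
  \sum_(i <- r) (2 * rad i) `^ s <=
  2 `^ (s + t) / (1 - 2 `^ (t - s)) * delta `^ (s - t).
Proof.
move=> ur d0 ts s0 hrad hcount.
have /choice[lev levP] : forall i, exists k : nat, i \in r ->
    delta * 2^-1 ^+ k.+1 < rad i /\ rad i <= delta * 2^-1 ^+ k.
  move=> i; have [ir|_] := boolP (i \in r); last by exists 0.
  by have [k hk] := dyadic_level (hrad i ir); exists k.
pose K := (\max_(i <- r) lev i).+1.
have levK i : i \in r -> (lev i < K)%N.
  by move=> ir; rewrite ltnS (big_rem i)//= leq_maxl.
set x : R := 2 `^ (t - s).
have x0 : 0 < x by rewrite powR_gt0.
have x1 : x < 1.
  have -> : 1 = 2 `^ 0 :> R by rewrite powRr0.
  rewrite /x /powR (gt_eqF (ltr0Sn _ 1)) ltr_expR.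
  by rewrite ltr_pM2r ?ln_gt0//; lra.
have -> : \sum_(i <- r) (2 * rad i) `^ s =
    \sum_(k < K) \sum_(i <- r | lev i == k) (2 * rad i) `^ s.
  rewrite (eq_bigr (fun k : 'I_K => \sum_(i <- r)
     (if lev i == k then (2 * rad i) `^ s else 0))); last first.
    by move=> k _; rewrite big_mkcond.
  rewrite exchange_big; apply: eq_big_seq => i ir /=.
  rewrite (bigD1 (Ordinal (levK i ir)))//= eqxx big1 ?addr0// => k.
  by rewrite -val_eqE/= eq_sym => /negbTE ->.
apply: (@le_trans _ _ (\sum_(k < K) 2 `^ (s + t) * delta `^ (s - t) * x ^+ k)).
  apply: ler_sum => k _; set h : R := 2^-1 ^+ k.
  have h0 : 0 < h by rewrite exprn_gt0.
  have h1 : h <= 1 by rewrite exprn_ile1//; lra.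
  have hS : 2^-1 ^+ k.+1 = h / 2 by rewrite exprSr.
  apply: (@le_trans _ _ (\sum_(i <- r | lev i == k) (2 * (delta * h)) `^ s)).
    rewrite big_seq_cond [leRHS]big_seq_cond; apply: ler_sum => i /andP[ir /eqP lk].
    have [_ hi] := levP i ir; have /andP[ri _] := hrad i ir.
    have dh0 : 0 < delta * h by rewrite mulr_gt0.
    rewrite lk -/h in hi.
    by apply: ge0_ler_powR; rewrite ?nnegrE//; lra.
  rewrite big_const_seq iter_addr_0 -size_filter -[leLHS]mulr_natl.
  set r' := [seq i <- r | lev i == k].
  have hr' : (size r')%:R <= (delta * h / 2) `^ (- t).
    apply: hcount.
    - by rewrite divr_gt0 ?mulr_gt0//=; nra.
    - exact: filter_uniq.
    - by move=> i; rewrite mem_filter => /andP[].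
    - move=> i; rewrite mem_filter => /andP[/eqP lk ir].
      by have [+ _] := levP i ir; rewrite lk hS mulrA.
  apply: (le_trans (ler_wpM2r (powR_ge0 _ _) hr')).
  rewrite /x -powR_mulrn ?powR_ge0// -powRrM.
  have -> : h = 2 `^ (- k%:R) by rewrite /h powR_invn// exprVn.
  rewrite -{1}[2]/(2%:R) -(powR_inv1 (ler0n _ 2)).
  rewrite !powRM ?powR_ge0 ?mulr_ge0 ?powR_ge0 ?(ltW d0)// -!powRrM.
  have dd : delta `^ (s - t) = delta `^ s * delta `^ (- t).
    by rewrite powRD// (gt_eqF d0) implybT.
  have t2 u v : (2 : R) `^ (u + v) = 2 `^ u * 2 `^ v.
    by rewrite powRD// (gt_eqF (ltr0Sn _ 1)) implybT.
  have e2 : (2 : R) `^ (s + t) * 2 `^ ((t - s) * k%:R) = 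
     2 `^ (- k%:R * - t) * 2 `^ (-1 * - t) * (2 `^ s * 2 `^ (- k%:R * s)).
    by rewrite -!t2; congr (_ `^ _); ring.
  rewrite dd [leRHS]mulrAC e2 le_eqVlt; apply/orP; left; apply/eqP.
  ring.
rewrite -mulr_sumr [leRHS]mulrAC ler_pM2l ?mulr_gt0 ?powR_gt0//.
have := @geometric_le_lim R K 1 x ler01 x0.
rewrite gtr0_norm// => /(_ x1); rewrite /series/= big_mkord div1r.
by rewrite (eq_bigr (fun k : 'I_K => x ^+ k))// => k _; rewrite /= mul1r.
Qed.

Section packing_dimension.
Variables (R : realType) (T : Type) (dist : T -> T -> R) (x0 : T).
Hypothesis distxx : forall x, dist x x = 0.
Hypothesis dist_sym : forall x y, dist x y = dist y x.
Hypothesis dist_triangle : forall x y z, dist x z <= dist x y + dist y z.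
Implicit Types (E B : set T) (r s t delta : R) (n : nat).

Lemma packing_delta_ge0 s delta E : (0 <= packing_delta dist s delta E)%E.
Proof.
apply: ereal_sup_ubound; exists set0, (fun _ => x0), (fun _ => 0).
by rewrite esum_set0; split=> //; split=> [i []|i j []].
Qed.

Lemma packing_delta_le s delta1 delta2 E : delta1 <= delta2 ->
  (packing_delta dist s delta1 E <= packing_delta dist s delta2 E)%E.
Proof.
move=> h12; apply/ereal_supP => y [D [c [rad [[cE cD] ->]]]].
apply: ereal_sup_ubound; exists D, c, rad; split=> //; split=> // i Di.
have [? /andP[? ?]] := cE i Di; split=> //; apply/andP; split=> //.
exact: le_trans h12.
Qed.

(** The limit defining the premeasure is monotone, hence an infimum; this also
    shows that it exists. *)
Lemma packing_premeasureE s E : packing_premeasure dist s E =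
  ereal_inf [set packing_delta dist s delta E | delta in `]0, +oo[].
Proof.
apply: cvg_lim => //.
apply: (@nondecreasing_at_right_cvge R _ 0 +oo%O) => // x y _ _.
exact: packing_delta_le.
Qed.

Lemma packing_premeasure_ge0 s E : (0 <= packing_premeasure dist s E)%E.
Proof.
rewrite packing_premeasureE; apply/ereal_infP => _ [d _ <-].
exact: packing_delta_ge0.
Qed.

Lemma packing_premeasure_lt s E x : (packing_premeasure dist s E < x)%E ->
  exists2 delta0, 0 < delta0 & forall delta, 0 < delta < delta0 ->
    (packing_delta dist s delta E < x)%E.
Proof.
rewrite packing_premeasureE => /ereal_inf_ltP[_ [d0 /= + <-] h].
rewrite in_itv/= andbT => d0gt; exists d0 => // d /andP[_ dd0].
by apply: le_lt_trans h; apply: packing_delta_le; exact: ltW.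
Qed.

Lemma diam_closed_disc_le x r :
  (diam dist (closed_disc dist x r) <= (2 * r)%:E)%E.
Proof.
apply/diam_leP => y z; rewrite /closed_disc/= => xy xz.
apply: (le_trans (dist_triangle y x z)); rewrite (dist_sym y); lra.
Qed.

Lemma diam_closed_disc_ge0 x r : 0 <= r ->
  (0 <= diam dist (closed_disc dist x r))%E.
Proof.
move=> r0; apply: ereal_sup_ubound; exists (x, x) => /=; last by rewrite distxx.
by rewrite /closed_disc/= distxx.
Qed.

(** Two centres in the same set of the cover are at distance at most eta, so
    the second one lies in both balls, which are disjoint. *)
Lemma packing_card_le E delta (D : set nat) c rad eta n (r : seq nat) :
  is_packing dist E delta D c rad -> coverable dist E eta n ->
  uniq r -> (forall i, i \in r -> D i /\ eta < rad i) -> (size r <= n)%N.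
Proof.
move=> [cE disj] [U [dU EU]] ur hr.
have /choice[f fP] : forall i, exists m : 'I_n.+1, i \in r ->
    exists j : 'I_n, (m = j :> nat) /\ U j (c i).
  move=> i; have [ir|_] := boolP (i \in r); last by exists ord0.
  have [Di _] := hr i ir; have [Ec _] := cE i Di.
  have [j _ Uj] := EU _ Ec.
  by exists (widen_ord (leqnSn n) j) => _; exists j.
have fn i : i \in r -> (f i < n)%N.
  by move=> /fP[j [-> _]].
have uf : uniq (map (fun i => f i : nat) r).
  rewrite map_inj_in_uniq// => i j ir jr fij.
  have [k [fk Uk]] := fP i ir; have [l [fl Ul]] := fP j jr.
  have kl : l = k by apply: val_inj; rewrite /= -fk -fl fij.
  rewrite kl in Ul; have [Di ri] := hr i ir; have [Dj rj] := hr j jr.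
  apply: (disj i j Di Dj); exists (c j); split; rewrite /closed_disc/=.
    by apply: (le_trans (dU _ _ _ Uk Ul)); exact: ltW.
  by rewrite distxx; have [_ /andP[/ltW]] := cE j Dj.
have := uniq_leq_size uf (s2 := iota 0 n).
rewrite size_map size_iota; apply => _ /mapP[i ir ->].
by rewrite mem_iota/= add0n fn.
Qed.

Lemma packing_delta_upper E s t delta delta0 : 0 < delta0 -> t < s -> 0 <= s ->
  0 < delta < delta0 ->
  (forall eta, 0 < eta < delta0 -> exists2 n, coverable dist E eta n &
     n%:R <= eta `^ (- t)) ->
  (packing_delta dist s delta E <=
    (2 `^ (s + t) / (1 - 2 `^ (t - s)) * delta `^ (s - t))%:E)%E.
Proof.
move=> d00 ts s0 /andP[d0 dd0] hcov.
apply/ereal_supP => _ [D [c [rad [pk ->]]]]; have [cE disj] := pk.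
apply/ereal_supP => _ [X [finX XD] <-]; rewrite fsbig_finite//=.
set r := finmap.enum_fset _.
have rD i : i \in r -> D i.
  move=> ir; apply: XD; rewrite -[X i]/(X i) -in_setE -in_fset_set//.
apply: (@le_trans _ _ (\sum_(i <- r) ((2 * rad i) `^ s)%:E)%E).
  rewrite big_seq [leRHS]big_seq; apply: lee_sum => i /rD /cE[_ /andP[ri _]].
  have r2 : 0 <= 2 * rad i by lra.
  rewrite -poweR_EFin; apply: gt0_ler_poweR => //.
  - by rewrite in_itv/= leey andbT diam_closed_disc_ge0// ltW.
  - by rewrite in_itv/= leey andbT lee_fin.
  - exact: diam_closed_disc_le.
rewrite sumEFin lee_fin; apply: dyadic_power_sum => //.
- exact: finmap.fset_uniq.
- by move=> i /rD /cE[].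
- move=> eta r' /andP[e0 ed] ur' r'r hr'.
  have [|n En nle] := hcov eta; first by rewrite e0 (lt_trans ed).
  apply: le_trans nle; rewrite ler_nat; apply: (packing_card_le pk En ur').
  by move=> i ir; split; [exact/rD/r'r|exact: hr'].
Qed.

(** The easy half of the comparison: packing dimension never exceeds upper box
    dimension. The set itself, repeated, is the countable cover used. *)
Lemma packing_dim_le E s t : t < s -> 0 <= s ->
  (upper_box_dim dist E < t%:E)%E -> (packing_dim dist E <= s%:E)%E.
Proof.
move=> ts s0 /upper_box_dim_lt[d0 d0gt hcov].
apply: ereal_inf_lbound; exists s => //; split=> //.
apply/eqP; rewrite eq_le; apply/andP; split; last first.
  apply/ereal_infP => _ [Ei _ <-]; apply: nneseries_ge0 => i _ _.
  exact: packing_premeasure_ge0.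
apply: ereal_inf_lbound; exists (fun _ => E); first by move=> x Ex; exists 0.
apply: eseries0 => i _ _; apply/eqP.
rewrite eq_le packing_premeasure_ge0 andbT.
set C := 2 `^ (s + t) / (1 - 2 `^ (t - s)).
have cv : C * a `^ (s - t) @[a --> 0^'+] --> C * 0.
  by apply: cvgMr; apply: powR_cvg0; lra.
rewrite mulr0 in cv.
apply/lee_addgt0Pr => e e0; rewrite add0e packing_premeasureE.
have /right0_nbhs[d1 d1gt hd1] : (0 : R)^'+ [set a | C * a `^ (s - t) < e].
  exact: (cvgr_lt _ cv).
pose d := Num.min d0 d1 / 2.
have dP : [/\ 0 < d, d < d0 & d < d1].
  rewrite /d; have : 0 < Num.min d0 d1 by rewrite lt_min d0gt.
  have : Num.min d0 d1 <= d0 by rewrite ge_min lexx.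
  have : Num.min d0 d1 <= d1 by rewrite ge_min lexx orbT.
  by split; lra.
case: dP => dgt dd0 dd1.
apply: (@le_trans _ _ (packing_delta dist s d E)).
  by apply: ereal_inf_lbound; exists d => //=; rewrite in_itv/= dgt.
apply: (@le_trans _ _ (C * d `^ (s - t))%:E).
  by apply: (@packing_delta_upper _ _ _ _ d0) => //; rewrite dgt.
by rewrite lee_fin; apply/ltW/hd1; rewrite dgt.
Qed.

(** A property of normed spaces that fails in general metric spaces. By it, the
    balls of radius r of a packing contribute at least (2 r)^s each. *)
Hypothesis diametral : forall x r, 0 < r -> exists y z,
  [/\ dist x y <= r, dist x z <= r & 2 * r <= dist y z].

Definition separated E delta n (c : nat -> T) :=
  (forall i, (i < n)%N -> E (c i)) /\
  (forall i j, (i < n)%N -> (j < n)%N -> i != j -> delta < dist (c i) (c j)).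

(** Points are added greedily while some point of E is still far from all of
    them; the bound on the sizes of separated families stops the process. *)
Lemma separated_net E delta (b : R) :
  (forall n c, separated E delta n c -> n%:R <= b) ->
  exists n c, [/\ separated E delta n c, n%:R <= b &
    forall z, E z -> exists2 i, (i < n)%N & dist z (c i) <= delta].
Proof.
move=> hb.
have step k : (exists c, separated E delta k c) \/
    exists n c, separated E delta n c /\
    forall z, E z -> exists2 i, (i < n)%N & dist z (c i) <= delta.
  elim: k => [|k [[c [cE cs]]|]]; [|have [mx|/existsNP[z /not_implyP[Ez nz]]] :=
      pselect (forall z, E z -> exists2 i, (i < k)%N & dist z (c i) <= delta)|].
  - by left; exists (fun _ => x0); split.
  - by right; exists k, c.
  - left; exists (fun i => if i == k then z else c i).
    have far i : (i < k)%N -> delta < dist z (c i).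
      by move=> ik; rewrite ltNge; apply/negP => zi; apply: nz; exists i.
    split=> [i|i j]; first by rewrite ltnS leq_eqVlt; case: eqP => //= _; exact: cE.
    rewrite !ltnS (leq_eqVlt i) (leq_eqVlt j).
    case: (i =P k) => [->|_] /=; case: (j =P k) => [->|_] /=; rewrite ?eqxx//.
    + by move=> _ jk _; exact: far.
    + by move=> ik _ _; rewrite dist_sym; exact: far.
    + exact: cs.
  - by right.
have [[c /hb nb]|[n [c [sc hc]]]] := step (Num.bound `|b|).
  have := archi_boundP (normr_ge0 b).
  by rewrite ltNge (le_trans nb)// ler_norm.
by exists n, c; split=> //; exact: hb sc.
Qed.

Lemma separated_card_le E s delta n c : 0 < delta -> 0 <= s ->
  (packing_delta dist s delta E <= 1)%E ->
  separated E (2 * delta) n c -> n%:R <= (2 * delta) `^ (- s).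
Proof.
move=> d0 s0 pk [cE cs].
have : ((n%:R * (2 * delta) `^ s)%:E <= packing_delta dist s delta E)%E.
  apply: le_ereal_sup_tmp; eexists; first exists `I_n, c, (fun _ => delta).
    split; last by []; split=> [i /cE|i j ni nj [z [/= zi zj]]].
      by rewrite d0 lexx.
    apply/eqP; apply: contraT => /(cs i j ni nj).
    have := dist_triangle (c i) z (c j); rewrite (dist_sym z).
    by move: zi zj; rewrite /closed_disc/=; lra.
  apply: esum_ge; exists `I_n; first by split; [exact: finite_II|].
  rewrite -fsbig_ord/=.
  apply: (@le_trans _ _ (\sum_(i < n) ((2 * delta) `^ s)%:E)%E).
    by rewrite sumEFin sumr_const card_ord mulr_natl.
  apply: lee_sum => i _; rewrite -poweR_EFin; apply: gt0_ler_poweR => //.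
  - by rewrite in_itv/= leey andbT lee_fin; lra.
  - by rewrite in_itv/= leey andbT diam_closed_disc_ge0// ltW.
  - have [y [z [xy xz yz]]] := diametral (c i) d0.
    apply: (@le_trans _ _ (dist y z)%:E); first by rewrite lee_fin.
    by apply: ereal_sup_ubound; exists (y, z).
move=> /le_trans /(_ pk); rewrite lee_fin.
by rewrite powRN -ler_pdivlMr ?div1r// powR_gt0//; lra.
Qed.

(** Disjoint balls of radius delta around a maximal 2 delta-separated family
    form a packing, so the family is small; enlarged balls around it then
    cover every set G in which E is dense. The constant is the same for
    closures, which is what makes the Baire argument possible. *)
Lemma coverable_of_premeasure_lt E s : 0 <= s ->
  (packing_premeasure dist s E < 1)%E ->
  exists2 delta0, 0 < delta0 & forall delta, 0 < delta < delta0 ->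
  forall G, (forall y e, G y -> 0 < e -> exists2 z, E z & dist y z < e) ->
  exists2 n, coverable dist G (6 * delta) n & n%:R <= (2 * delta) `^ (- s).
Proof.
move=> s0 /packing_premeasure_lt[d0 d0gt hd]; exists d0 => // d hdd G GE.
have /andP[dgt dd0] := hdd; have /ltW pk := hd _ hdd.
have [n [c [[cE cs] nb cov]]] := separated_net
  (fun n c => separated_card_le dgt s0 pk (n := n) (c := c)).
exists n => //; exists (fun i y => dist y (c i) <= 3 * d); split.
  move=> i x y xi yi; apply: (le_trans (dist_triangle x (c i) y)).
  by rewrite (dist_sym _ y); lra.
move=> y Gy; have [z Ez yz] := GE y d Gy dgt.
have [i ni zi] := cov z Ez; exists (Ordinal ni) => //=.
by apply: (le_trans (dist_triangle y z _)); lra.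
Qed.

End packing_dimension.

(** * Diagonal and antidiagonal matrices *)

Section monomial_matrices.
Variable R : realType.
Implicit Types (A B : 'M[R]_2) (u v : 'cV[R]_2).

Lemma ord2_add11 : 1 + 1 = 0 :> 'I_2.
Proof. exact: val_inj. Qed.

Lemma sum_ord2 (f : 'I_2 -> R) : \sum_i f i = f 0 + f 1.
Proof.
by rewrite !big_ord_recl big_ord0 addr0; congr (_ + f _); apply: val_inj.
Qed.

Lemma ord2P (P : 'I_2 -> Prop) : P 0 -> P 1 -> forall i, P i.
Proof.
move=> P0 P1 [[|[|//]] h].
  by rewrite (_ : Ordinal h = 0)//; apply: val_inj.
by rewrite (_ : Ordinal h = 1)//; apply: val_inj.
Qed.

Lemma mulmx2E n p (A : 'M[R]_(n, 2)) (B : 'M[R]_(2, p)) i j :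
  (A *m B) i j = A i 0 * B 0 j + A i 1 * B 1 j.
Proof. by rewrite mxE sum_ord2. Qed.

Lemma euclidE v : euclid v = Num.sqrt (v 0 0 ^+ 2 + v 1 0 ^+ 2).
Proof. by rewrite /euclid sum_ord2. Qed.

(** Diagonal or antidiagonal. Each row has a single possibly nonzero entry,
    so that the sum of absolute values [row_size] recovers its size. *)
Definition monomial A :=
  A 0 1 = 0 /\ A 1 0 = 0 \/ A 0 0 = 0 /\ A 1 1 = 0.

Definition row_size A i := `|A i 0| + `|A i 1|.
Definition wmax A := Num.max (row_size A 0) (row_size A 1).
Definition wmin A := Num.min (row_size A 0) (row_size A 1).

Lemma row_size_ge0 A i : 0 <= row_size A i.
Proof. by rewrite addr_ge0. Qed.

Lemma monomial_mulmx_vec A : monomial A ->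
  (forall v i, `|(A *m v) i 0| = row_size A i * `|v i 0|) \/
  (forall v i, `|(A *m v) i 0| = row_size A i * `|v (i + 1) 0|).
Proof.
move=> [[h1 h2]|[h1 h2]]; [left|right] => v; apply: ord2P;
  rewrite mulmx2E /row_size ?add0r ?ord2_add11 ?h1 ?h2 ?mul0r ?normr0;
  by rewrite ?addr0 ?add0r normrM.
Qed.

Lemma monomial_mulmx A B : monomial A -> monomial B ->
  monomial (A *m B) /\
  ((forall i, row_size (A *m B) i = row_size A i * row_size B i) \/
   (forall i, row_size (A *m B) i = row_size A i * row_size B (i + 1))).
Proof.
move=> [[h1 h2]|[h1 h2]] [[k1 k2]|[k1 k2]]; (split;
 [rewrite /monomial !mulmx2E h1 h2 k1 k2;
  first [by left; split; ring | by right; split; ring]|]);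
 [left|left|right|right]; apply: ord2P;
 rewrite /row_size !mulmx2E ?add0r ?ord2_add11 ?h1 ?h2 ?k1 ?k2 ?mulr0 ?mul0r;
 by rewrite ?normr0 ?addr0 ?add0r ?normr0 ?add0r ?addr0 ?normrM.
Qed.

Lemma monomial_scalar1 : monomial 1%:M /\ forall i, row_size 1%:M i = 1.
Proof.
split; first by left; rewrite !mxE.
by apply: ord2P; rewrite /row_size !mxE/= normr0 normr1 ?addr0 ?add0r.
Qed.

(** A^T A is diagonal, with the squared row sizes as entries in one order or
    the other; p and q are those row sizes in the right order. *)
Lemma tr_mulmx_monomial A : monomial A ->
  exists p q, [/\ p \in [:: row_size A 0; row_size A 1],
    q \in [:: row_size A 0; row_size A 1],
    Num.max p q = wmax A, Num.min p q = wmin A &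
    forall v : 'rV[R]_2, v *m (A^T *m A) =
      \row_j [:: v 0 0 * p ^+ 2; v 0 1 * q ^+ 2]`_j].
Proof.
move=> [[h1 h2]|[h1 h2]].
  exists (row_size A 0), (row_size A 1); split; rewrite ?inE ?eqxx ?orbT// => v.
  apply/matrixP => i j; rewrite !ord1 {i}; move: j; apply: ord2P;
  rewrite mulmx2E [in RHS]mxE/= !mulmx2E !mxE /row_size h1 h2 ?normr0;
  rewrite ?addr0 ?add0r real_normK ?num_real//; ring.
exists (row_size A 1), (row_size A 0).
split; [by rewrite !inE eqxx orbT|by rewrite !inE eqxx|exact: maxC|exact: minC|].
move=> v.
apply/matrixP => i j; rewrite !ord1 {i}; move: j; apply: ord2P;
rewrite mulmx2E [in RHS]mxE/= !mulmx2E !mxE /row_size h1 h2 ?normr0;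
rewrite ?addr0 ?add0r real_normK ?num_real//; ring.
Qed.

Lemma eigenvalue_monomial A : monomial A ->
  [set l : R | eigenvalue (A^T *m A) l] = [set wmax A ^+ 2; wmin A ^+ 2].
Proof.
move=> /tr_mulmx_monomial[p [q [pA qA <- <- ev]]].
have p0 : 0 <= p by move: pA; rewrite !inE => /orP[]/eqP->; exact: row_size_ge0.
have q0 : 0 <= q by move: qA; rewrite !inE => /orP[]/eqP->; exact: row_size_ge0.
have -> : [set Num.max p q ^+ 2; Num.min p q ^+ 2] = [set p ^+ 2; q ^+ 2].
  by case: (leP p q) => //; rewrite setUC.
apply/seteqP; split=> l /=.
  move=> /eigenvalueP[v]; rewrite ev => /rowP vl v0.
  have := vl 0; have := vl 1; rewrite !mxE/= => l1 l0.
  have [v00|v00] := eqVneq (v 0 0) 0.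
    right; apply: (@mulfI _ (v 0 1)); last by rewrite l1 mulrC.
    apply: contraNneq v0 => v01; apply/eqP/rowP; apply: ord2P; rewrite mxE//.
  by left; apply: (@mulfI _ (v 0 0)); rewrite // l0 mulrC.
have nz (j : 'I_2) : delta_mx 0 j != 0 :> 'rV[R]_2.
  apply/negP => /eqP/rowP/(_ j); rewrite !mxE !eqxx => /eqP.
  by rewrite oner_eq0.
case=> ->; apply/eigenvalueP; [exists (delta_mx 0 0)|exists (delta_mx 0 1)] => //;
  by rewrite ev; apply/rowP; apply: ord2P; rewrite !mxE/= ?mul0r ?mulr0 ?mul1r ?mulr1.
Qed.

Lemma wmin_ge0 A : 0 <= wmin A.
Proof. by rewrite le_min !row_size_ge0. Qed.

Lemma wmin_le_wmax A : wmin A <= wmax A.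
Proof. by rewrite le_max ge_min lexx. Qed.

Lemma row_size_le A i : row_size A i <= wmax A.
Proof. by move: i; apply: ord2P; rewrite /wmax le_max lexx ?orbT. Qed.

Lemma row_size_ge A i : wmin A <= row_size A i.
Proof. by move: i; apply: ord2P; rewrite /wmin ge_min lexx ?orbT. Qed.

Lemma wmax_ge0 A : 0 <= wmax A.
Proof. exact: le_trans (wmin_ge0 A) (wmin_le_wmax A). Qed.

Lemma sing1_monomial A : monomial A -> sing1 A = wmax A.
Proof.
move=> mA; rewrite /sing1 eigenvalue_monomial//.
have le2 : wmin A ^+ 2 <= wmax A ^+ 2 by 
  rewrite ler_sqr ?nnegrE ?wmin_ge0 ?wmax_ge0 ?wmin_le_wmax.
have -> : sup [set wmax A ^+ 2; wmin A ^+ 2] = wmax A ^+ 2.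
  have ubS : ubound [set wmax A ^+ 2; wmin A ^+ 2] (wmax A ^+ 2) by move=> _ [|] ->.
  apply/eqP; rewrite eq_le; apply/andP; split.
    by apply: ge_sup => //; exists (wmax A ^+ 2); left.
  by apply: ub_le_sup; [exists (wmax A ^+ 2)|left].
by rewrite sqrtr_sqr ger0_norm// wmax_ge0.
Qed.

Lemma sing2_monomial A : monomial A -> sing2 A = wmin A.
Proof.
move=> mA; rewrite /sing2 eigenvalue_monomial//.
have le2 : wmin A ^+ 2 <= wmax A ^+ 2 by 
  rewrite ler_sqr ?nnegrE ?wmin_ge0 ?wmax_ge0 ?wmin_le_wmax.
have -> : inf [set wmax A ^+ 2; wmin A ^+ 2] = wmin A ^+ 2.
  have lbS : lbound [set wmax A ^+ 2; wmin A ^+ 2] (wmin A ^+ 2) by move=> _ [|] ->.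
  apply/eqP; rewrite eq_le; apply/andP; split.
    by apply: ge_inf; [exists (wmin A ^+ 2)|right].
  by apply: lb_le_inf => //; exists (wmax A ^+ 2); left.
by rewrite sqrtr_sqr ger0_norm// wmin_ge0.
Qed.

(** Applying L to the corners of the square bounds both row sizes by 1, while
    the squares of the four entries add up to 2 because the columns are unit
    vectors. So a b = c d = 0 in absolute values, and L is a signed
    permutation matrix. *)
Lemma square_isometry_monomial (L : 'M[R]_2) :
  (forall v, euclid (L *m v) = euclid v) ->
  mulmx L @` (@unit_square R) = @unit_square R ->
  monomial L /\ forall i, row_size L i = 1.
Proof.
move=> iso sq.
pose vec (x y : R) : 'cV[R]_2 := \col_i [:: x; y]`_i.
have isoE x y : (L 0 0 * x + L 0 1 * y) ^+ 2 + (L 1 0 * x + L 1 1 * y) ^+ 2 =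
    x ^+ 2 + y ^+ 2.
  have := iso (vec x y); rewrite !euclidE !mulmx2E !mxE/= => /eqP.
  by rewrite eqr_sqrt ?addr_ge0 ?sqr_ge0// => /eqP.
have sqE x y : `|x| <= 1 -> `|y| <= 1 -> forall i, `|L i 0 * x + L i 1 * y| <= 1.
  move=> x1 y1 i.
  have : unit_square (L *m vec x y).
    rewrite -sq; exists (vec x y) => //; apply: ord2P; rewrite mxE//.
  by move=> /(_ i); rewrite mulmx2E !mxE.
have n1 : `|1 : R| <= 1 by rewrite normr1.
have nN1 : `|- 1 : R| <= 1 by rewrite normrN1.
have row i : row_size L i <= 1.
  have := sqE _ _ n1 n1 i; have := sqE _ _ n1 nN1 i.
  rewrite /row_size => /ler_normlP[? ?] /ler_normlP[? ?].
  by case: (ger0P (L i 0)) => ?; case: (ger0P (L i 1)) => ?; lra.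
have := isoE 1 0; have := isoE 0 1.
have := row 0; have := row 1; rewrite /row_size.
set a := L 0 0; set b := L 0 1; set c := L 1 0; set d := L 1 1 => r1 r0 e1 e0.
have sq2 (x : R) : x ^+ 2 = `|x| ^+ 2 by rewrite real_normK ?num_real.
have tot : `|a| ^+ 2 + `|b| ^+ 2 + (`|c| ^+ 2 + `|d| ^+ 2) = 2.
  by rewrite -!sq2; lra.
have colac : `|a| ^+ 2 + `|c| ^+ 2 = 1 by rewrite -!sq2; lra.
have colbd : `|b| ^+ 2 + `|d| ^+ 2 = 1 by rewrite -!sq2; lra.
have [a0 b0 c0 d0] : [/\ 0 <= `|a|, 0 <= `|b|, 0 <= `|c| & 0 <= `|d|] by [].
have ab0 : `|a| * `|b| = 0.
  by apply/eqP; rewrite eq_le mulr_ge0// andbT; nra.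
have cd0 : `|c| * `|d| = 0.
  by apply/eqP; rewrite eq_le mulr_ge0// andbT; nra.
have sq1 (x : R) : 0 <= x -> x ^+ 2 = 1 -> x = 1.
  by move=> x0 /eqP; rewrite sqrp_eq1// => /eqP.
move: ab0 => /eqP; rewrite mulf_eq0 => /orP[]/eqP h.
  rewrite h expr0n/= add0r in colac; have c1 := sq1 _ c0 colac.
  move: cd0; rewrite c1 mul1r => hd.
  rewrite hd expr0n/= addr0 in colbd; have b1 := sq1 _ b0 colbd.
  split; last by apply: ord2P; rewrite -/a -/b -/c -/d ?h ?c1 ?hd ?b1 ?add0r ?addr0.
  by right; split; apply/eqP; rewrite -normr_eq0; apply/eqP.
rewrite h expr0n/= add0r in colbd; have d1 := sq1 _ d0 colbd.
move: cd0; rewrite d1 mulr1 => hc.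
rewrite hc expr0n/= addr0 in colac; have a1 := sq1 _ a0 colac.
split; last by apply: ord2P; rewrite -/a -/b -/c -/d ?h ?a1 ?hc ?d1 ?add0r ?addr0.
by left; split; apply/eqP; rewrite -normr_eq0; apply/eqP.
Qed.

Lemma wmax_mulmx A B : monomial A -> monomial B ->
  wmax (A *m B) <= wmax A * wmax B.
Proof.
move=> mA mB; have [_ h] := monomial_mulmx mA mB.
rewrite {1}/wmax ge_max.
have rA i := row_size_le A i.
have rB i := row_size_le B i.
by case: h => h; rewrite !h; apply/andP; split; rewrite ler_pM ?row_size_ge0.
Qed.

Lemma wmin_mulmx A B : monomial A -> monomial B ->
  wmin A * wmin B <= wmin (A *m B).
Proof.
move=> mA mB; have [_ h] := monomial_mulmx mA mB.
rewrite {3}/wmin le_min.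
have rA i := row_size_ge A i.
have rB i := row_size_ge B i.
by case: h => h; rewrite !h; apply/andP; split; rewrite ler_pM ?wmin_ge0.
Qed.

Lemma wmax_mulmx_ge A B : monomial A -> monomial B ->
  wmax A * wmin B <= wmax (A *m B).
Proof.
move=> mA mB; have [_ h] := monomial_mulmx mA mB.
have rB i := row_size_ge B i.
have hi i : row_size A i * wmin B <= row_size (A *m B) i.
  by case: h => ->; rewrite ler_wpM2l ?row_size_ge0.
rewrite {1}/wmax maxr_pMl ?wmin_ge0//.
by rewrite ge_max !(le_trans (hi _))// /wmax le_max lexx ?orbT.
Qed.

(** For f the identity this is the absolute value of the determinant. *)
Lemma wmax_wmin_fun (f : R -> R) A :
  f (wmax A) * f (wmin A) = f (row_size A 0) * f (row_size A 1).
Proof.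
by rewrite /wmax /wmin; case: (leP (row_size A 0)) => //; rewrite mulrC.
Qed.

Lemma wmax_wmin_mulmx A B : monomial A -> monomial B ->
  wmax (A *m B) * wmin (A *m B) = (wmax A * wmin A) * (wmax B * wmin B).
Proof.
move=> mA mB; have [_ h] := monomial_mulmx mA mB.
rewrite !(wmax_wmin_fun id); case: h => h; rewrite !h ?add0r ?ord2_add11; ring.
Qed.

End monomial_matrices.

(** * Sums over words and cuts of the tree of words *)

Section words.
Variables (R : realType) (I : finType).
Implicit Types (u v w : seq I) (f phi : seq I -> R) (stop : pred (seq I)).

Definition word_sum (m : nat) f : R := \sum_(w : m.-tuple I) f w.

Lemma word_sum0 f : word_sum 0 f = f [::].
Proof.
rewrite /word_sum (bigD1 [tuple])//= big1 ?addr0// => t.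
by rewrite tuple0.
Qed.

Lemma word_sumS m f :
  word_sum m.+1 f = \sum_i word_sum m (fun w => f (i :: w)).
Proof.
rewrite /word_sum pair_big/=.
rewrite (reindex (fun p : I * m.-tuple I => [tuple of p.1 :: p.2]))/=.
  by apply: eq_bigr => -[].
exists (fun t : m.+1.-tuple I => (thead t, [tuple of behead t])).
  by move=> [i t] _; rewrite /= theadE; congr pair; apply: val_inj.
by move=> t _; rewrite /= -tuple_eta.
Qed.

Lemma word_sum_ge0 m f : (forall w, 0 <= f w) -> 0 <= word_sum m f.
Proof. by move=> f0; apply: sumr_ge0. Qed.

(** Words obtained from w by appending letters until [stop] holds, with at most
    n letters appended. When n is large enough they form a maximal antichain
    above w, and the cylinders of these words cover that of w. *)
Fixpoint word_cut stop n w : seq (seq I) :=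
  if n is n'.+1 then
    if stop w then [:: w]
    else flatten [seq word_cut stop n' (rcons w i) | i <- enum I]
  else [:: w].

Lemma big_cutS stop n w f : ~~ stop w ->
  \sum_(u <- word_cut stop n.+1 w) f u =
  \sum_i \sum_(u <- word_cut stop n (rcons w i)) f u.
Proof.
by move=> /negbTE /= ->; rewrite big_flatten/= big_map big_enum.
Qed.

Lemma mem_cut stop n w u : u \in word_cut stop n w ->
  exists2 v, u = w ++ v & (size v <= n)%N /\
    forall v1 v2, v = v1 ++ v2 -> v2 != [::] -> ~~ stop (w ++ v1).
Proof.
elim: n w => [|n IH] w /=.
  rewrite inE => /eqP ->; exists [::]; rewrite ?cats0//; split=> // v1 v2.
  by move=> /esym /eqP; rewrite -size_eq0 size_cat addn_eq0 => /andP[_ /eqP/size0nil->].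
have [_|nst] := boolP (stop w).
  rewrite inE => /eqP ->; exists [::]; rewrite ?cats0//; split=> // v1 v2.
  by move=> /esym /eqP; rewrite -size_eq0 size_cat addn_eq0 => /andP[_ /eqP/size0nil->].
move=> /flatten_mapP[i _ /IH[v -> [sv hv]]].
exists (i :: v); first by rewrite cat_rcons.
split=> // -[|j v1] v2 /=; first by rewrite cats0.
by move=> [<- vE] v20; rewrite -cat_rcons; exact: hv vE v20.
Qed.

Lemma uniq_flatten_map (A B : eqType) (g : A -> seq B) (s : seq A) :
  uniq s -> (forall a, a \in s -> uniq (g a)) ->
  (forall a b x, a \in s -> b \in s -> x \in g a -> x \in g b -> a = b) ->
  uniq (flatten [seq g a | a <- s]).
Proof.
elim: s => //= a s IH /andP[as_ us] ug dj.
rewrite cat_uniq ug ?mem_head//=; apply/andP; split.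
  apply/hasPn => x /flatten_mapP[b bs xb]; apply/negP => xa.
  move/negP: as_; apply; rewrite (dj a b x)// ?mem_head// inE bs orbT//.
apply: IH => // [b bs|b c x bs cs]; first by rewrite ug// inE bs orbT.
by apply: dj; rewrite inE ?bs ?cs orbT.
Qed.

Lemma cut_uniq stop n w : uniq (word_cut stop n w).
Proof.
elim: n w => //= n IH w; case: ifP => // _; apply: uniq_flatten_map => //.
  exact: enum_uniq.
move=> i j u _ _ /mem_cut[v -> _] /mem_cut[v' + _].
rewrite !cat_rcons => /eqP.
by rewrite eqseq_cat// eqxx/= eqseq_cons => /andP[/eqP].
Qed.

Lemma cut_antichain stop n w u1 u2 : {in word_cut stop n w, forall u, stop u} ->
  u1 \in word_cut stop n w -> u2 \in word_cut stop n w -> u1 != u2 ->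
  ~~ prefix u1 u2.
Proof.
move=> hst hu1 /[dup] /mem_cut[v2 -> [_ nst]] _ ne.
have [v1 e1 _] := mem_cut hu1.
apply/negP => /prefixP[v3]; rewrite e1 -catA => /eqP.
rewrite eqseq_cat// eqxx/= => /eqP e2.
have := nst v1 v3 e2; rewrite -e1 hst//= => h.
by move: ne; rewrite e1 e2; case: v3 {e2} h => [_|? ? /(_ isT)//]; rewrite cats0 eqxx.
Qed.

Lemma cut_stop stop n w N : (forall u, (N <= size u)%N -> stop u) ->
  (N <= size w + n)%N -> {in word_cut stop n w, forall u, stop u}.
Proof.
move=> hN; elim: n w => [|n IH] w hw u /=.
  by rewrite inE => /eqP->; apply: hN; rewrite addn0 in hw.
have [sw|_] := boolP (stop w); first by rewrite inE => /eqP->.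
move=> /flatten_mapP[i _]; apply: IH.
by rewrite size_rcons addSnnS.
Qed.

Lemma cut_sum_le stop n w f : (forall u, 0 <= f u) ->
  \sum_(u <- word_cut stop n w) f u <=
  \sum_(m < n.+1) word_sum m (fun v => f (w ++ v)).
Proof.
move=> f0; elim: n w => [|n IH] w.
  by rewrite /= big_seq1 big_ord1 word_sum0 cats0.
have [sw|nsw] := boolP (stop w).
  rewrite /= sw big_seq1 big_ord_recl word_sum0 cats0 lerDl.
  by apply: sumr_ge0 => i _; exact: word_sum_ge0.
rewrite big_cutS//; apply: (@le_trans _ _ (\sum_i \sum_(m < n.+1)
   word_sum m (fun v => f (rcons w i ++ v)))); first exact: ler_sum.
rewrite exchange_big/= [leRHS]big_ord_recl word_sum0.
rewrite -[leLHS]add0r lerD//; apply: ler_sum => m _.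
rewrite /bump/= word_sumS; apply: ler_sum => i _.
by apply: ler_sum => v _; rewrite cat_rcons.
Qed.

Section finite_section.
Variable phi : seq I -> R.
Hypothesis phi_ge0 : forall w, 0 <= phi w.
Hypothesis phi_submul : forall u v, phi (u ++ v) <= phi u * phi v.

(** Words are split at the point where they cross the cut. *)
Lemma cut_submul stop n w m : (n <= m)%N ->
  word_sum m (fun v => phi (w ++ v)) <=
  \sum_(u <- word_cut stop n w) phi u * word_sum (m + size w - size u) phi.
Proof.
have base k w' : word_sum k (fun v => phi (w' ++ v)) <=
    phi w' * word_sum (k + size w' - size w') phi.
  rewrite addnK [leRHS]mulr_sumr; apply: ler_sum => v _; exact: phi_submul.
elim: n w m => [|n IH] w m nm; first by rewrite /= big_seq1.
have [sw|nsw] := boolP (stop w); first by rewrite /= sw big_seq1.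
rewrite big_cutS//; case: m nm => // m; rewrite ltnS => nm.
rewrite word_sumS; apply: ler_sum => i _.
apply: (le_trans _ (le_trans (IH (rcons w i) m nm) _)).
  by apply: ler_sum => v _; rewrite cat_rcons.
by rewrite size_rcons addSnnS.
Qed.

Lemma shifted_sum_le (g : nat -> R) N m K : (forall k, 0 <= g k) ->
  (m <= N)%N -> \sum_(N <= k < K) g (k - m)%N <= \sum_(0 <= k < K) g k.
Proof.
move=> g0 mN; apply: (@le_trans _ _ (\sum_(0 <= k < K - m) g k)).
  elim: K => [|K IH]; first by rewrite big_geq// sumr_ge0.
  have [KN|NK] := ltnP K N; first by rewrite big_geq// sumr_ge0.
  by rewrite big_nat_recr//= subSn ?(leq_trans mN)// big_nat_recr//= lerD2r.
by rewrite [leRHS](@big_cat_nat _ _ _ (K - m))//= ?leq_subr// lerDl sumr_ge0.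
Qed.

(** With q the mass of the cut, splitting every long word at the cut gives
    Z_K <= Z_n + q Z_K for the partial sums Z_K, hence Z_K <= Z_n / (1 - q). *)
Lemma summable_of_cut stop n :
  (forall u, u \in word_cut stop n [::] -> u != [::]) ->
  \sum_(u <- word_cut stop n [::]) phi u < 1 ->
  exists M, forall K, \sum_(0 <= k < K) word_sum k phi <= M.
Proof.
move=> ne; set q := \sum_(u <- _) _ => q1.
pose Z K := \sum_(0 <= k < K) word_sum k phi.
have Phi0 k : 0 <= word_sum k phi by exact: word_sum_ge0.
exists (Z n / (1 - q)) => K; rewrite ler_pdivlMr ?subr_gt0// -/(Z K).
have Z0 : 0 <= Z n by apply: sumr_ge0.
have [Kn|nK] := leqP K n.
  have q0 : 0 <= q by apply: sumr_ge0.
  have : Z K <= Z n.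
    by rewrite /Z [leRHS](@big_cat_nat _ _ _ K)//= lerDl sumr_ge0.
  have : 0 <= Z K by apply: sumr_ge0.
  nra.
have h k : (n <= k)%N -> word_sum k phi <=
    \sum_(u <- word_cut stop n [::]) phi u * word_sum (k - size u) phi.
  by move=> nk; have := @cut_submul stop n [::] k nk; rewrite addn0.
suff : \sum_(n <= k < K) word_sum k phi <= q * Z K.
  have ZK : Z K = Z n + \sum_(n <= k < K) word_sum k phi.
    by rewrite /Z (@big_cat_nat _ _ _ n)//=; exact: ltnW.
  by rewrite mulrBr mulr1 (mulrC (Z K)); move: ZK; lra.
apply: (@le_trans _ _ (\sum_(n <= k < K)
   \sum_(u <- word_cut stop n [::]) phi u * word_sum (k - size u) phi)).
  by rewrite big_nat [leRHS]big_nat; apply: ler_sum => k /andP[nk _]; exact: h.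
rewrite exchange_big/= mulr_suml big_seq [leRHS]big_seq.
apply: ler_sum => u /mem_cut[v -> [sv _]]; rewrite -mulr_sumr.
by apply: ler_wpM2l => //; apply: shifted_sum_le.
Qed.

End finite_section.
End words.

(** * The Euclidean plane and the maps coded by words *)

Section euclidean_plane.
Variable R : realType.
Implicit Types (A : 'M[R]_2) (u v w : 'cV[R]_2).

Lemma coord_le_euclid v i : `|v i 0| <= euclid v.
Proof.
rewrite euclidE -sqrtr_sqr ler_wsqrtr//.
by move: i; apply: ord2P; rewrite ?lerDl ?lerDr sqr_ge0.
Qed.

Lemma euclid_ge0 v : 0 <= euclid v. Proof. exact: sqrtr_ge0. Qed.

Lemma sqr_euclid v : euclid v ^+ 2 = v 0 0 ^+ 2 + v 1 0 ^+ 2.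
Proof. by rewrite euclidE sqr_sqrtr// addr_ge0 ?sqr_ge0. Qed.

Lemma euclid_le_coord v m : (forall i, `|v i 0| <= m) -> euclid v <= 2 * m.
Proof.
move=> h; have m0 : 0 <= m by apply: le_trans (h 0).
rewrite -ler_sqr ?nnegrE ?euclid_ge0 ?mulr_ge0// sqr_euclid.
have sq i : v i 0 ^+ 2 <= m ^+ 2.
  by rewrite -real_normK ?num_real// ler_sqr ?nnegrE.
by have := sq 0; have := sq 1; rewrite exprMn; have := sqr_ge0 m; lra.
Qed.

Lemma euclidD u v : euclid (u + v) <= euclid u + euclid v.
Proof.
have := euclid_ge0 u; have := euclid_ge0 v => v0 u0.
rewrite -ler_sqr ?nnegrE ?euclid_ge0 ?addr_ge0// sqrrD !sqr_euclid !mxE.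
suff : u 0 0 * v 0 0 + u 1 0 * v 1 0 <= euclid u * euclid v.
  by rewrite -mulr_natl; lra.
apply: (le_trans (ler_norm _)).
rewrite -ler_sqr ?nnegrE ?mulr_ge0// exprMn !sqr_euclid real_normK ?num_real//.
have := sqr_ge0 (u 0 0 * v 1 0 - u 1 0 * v 0 0); lra.
Qed.

Lemma euclidN v : euclid (- v) = euclid v.
Proof. by rewrite !euclidE !mxE !sqrrN. Qed.

Lemma euclid0 : euclid (0 : 'cV[R]_2) = 0.
Proof. by rewrite euclidE !mxE expr0n/= addr0 sqrtr0. Qed.

Lemma euclid_distxx u : euclid_dist u u = 0.
Proof. by rewrite /euclid_dist subrr euclid0. Qed.

Lemma euclid_dist_sym u v : euclid_dist u v = euclid_dist v u.
Proof. by rewrite /euclid_dist -euclidN opprB. Qed.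

Lemma euclid_dist_triangle u v w :
  euclid_dist u w <= euclid_dist u v + euclid_dist v w.
Proof. by rewrite /euclid_dist -(subrKA v) euclidD. Qed.

Lemma euclid_diametral u r : 0 < r -> exists v w,
  [/\ euclid_dist u v <= r, euclid_dist u w <= r & 2 * r <= euclid_dist v w].
Proof.
move=> r0; pose e : 'cV[R]_2 := \col_i [:: r; 0]`_i.
have ee : euclid e = r.
  by rewrite euclidE !mxE/= expr0n/= addr0 sqrtr_sqr gtr0_norm.
exists (u - e), (u + e); rewrite /euclid_dist; split.
- by rewrite opprB addrC subrK ee.
- by rewrite opprD addrA subrr add0r euclidN ee.
- rewrite opprD addrACA subrr add0r -opprD euclidN.
  have -> : e + e = \col_i [:: 2 * r; 0]`_i.
    by apply/matrixP => i j; rewrite ord1 !mxE; move: i; apply: ord2P => /=; ring.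
  by rewrite euclidE !mxE/= expr0n/= addr0 sqrtr_sqr gtr0_norm ?mulr_gt0.
Qed.

Lemma euclid_mulmx A v : monomial A ->
  wmin A * euclid v <= euclid (A *m v) <= wmax A * euclid v.
Proof.
move=> mA; have m0 := wmin_ge0 A; have M0 := wmax_ge0 A.
have sqn (x : R) : x ^+ 2 = `|x| ^+ 2 by rewrite real_normK ?num_real.
have sqr_sz i : wmin A ^+ 2 <= row_size A i ^+ 2 <= wmax A ^+ 2.
  by rewrite !ler_sqr ?nnegrE ?row_size_ge0// row_size_ge row_size_le.
have e01 : 0 + 1 = 1 :> 'I_2 by apply: val_inj.
have := sqr_sz 0; have := sqr_sz 1 => /andP[? ?] /andP[? ?].
have := sqr_ge0 `|v 0 0|; have := sqr_ge0 `|v 1 0| => ? ?.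
rewrite -[X in X && _]ler_sqr ?nnegrE ?mulr_ge0 ?euclid_ge0//.
rewrite -[X in _ && X]ler_sqr ?nnegrE ?mulr_ge0 ?euclid_ge0//.
rewrite !exprMn !sqr_euclid !(sqn ((A *m v) _ _)) !(sqn (v _ _)).
by have [h|h] := monomial_mulmx_vec mA; rewrite !h ?ord2_add11 ?e01 !exprMn;
  apply/andP; split; nra.
Qed.

End euclidean_plane.

Section words_of_maps.
Variables (R : realType) (I : finType) (S : boxlike_ifs R I).
Implicit Types (u v w : seq I) (x y z : 'cV[R]_2) (s : R).

(** The default value, as that of [ratio_min], only has to keep the result in
    the interval ]0, 1[ or ]0, 1] for every index set. *)
Definition ratio_max : R := \big[Num.max/2^-1]_i Num.max (bl_a S i) (bl_b S i).
Definition ratio_min : R := \big[Num.min/1]_i Num.min (bl_a S i) (bl_b S i).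

Lemma ratio_max_lt1 : ratio_max < 1.
Proof.
rewrite /ratio_max; elim/big_ind: _ => [|x y x1 y1|i _]; first lra.
  by rewrite gt_max x1.
have /andP[_ ?] := bl_aP S i; have /andP[_ ?] := bl_bP S i.
by rewrite gt_max; apply/andP.
Qed.

Lemma ratio_max_gt0 : 0 < ratio_max.
Proof. by apply: (lt_le_trans _ (bigmax_ge_id _ _ _ _)); lra. Qed.

Lemma ratio_min_gt0 : 0 < ratio_min.
Proof.
rewrite /ratio_min; elim/big_ind: _ => [|x y x1 y1|i _]; first by [].
  by rewrite lt_min x1.
have /andP[? _] := bl_aP S i; have /andP[? _] := bl_bP S i.
by rewrite lt_min; apply/andP.
Qed.

Lemma ratio_min_le1 : ratio_min <= 1.
Proof. exact: bigmin_le_id. Qed.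

Lemma monomial_bl_lin i : monomial (bl_lin S i) /\
  row_size (bl_lin S i) 0 = bl_a S i /\ row_size (bl_lin S i) 1 = bl_b S i.
Proof.
have [mL rL] := square_isometry_monomial (bl_isometry S i) (bl_square S i).
have E k j : bl_lin S i k j = [:: bl_a S i; bl_b S i]`_k * bl_L S i k j.
  by rewrite /bl_lin /bl_T mul_diag_mx !mxE.
have /andP[a0 _] := bl_aP S i; have /andP[b0 _] := bl_bP S i.
split.
  by case: mL => -[h1 h2]; [left|right]; rewrite !E h1 h2 !mulr0.
have rs (k : 'I_2) : 0 < [:: bl_a S i; bl_b S i]`_k ->
    row_size (bl_lin S i) k = [:: bl_a S i; bl_b S i]`_k.
  move=> p; rewrite /row_size !E !normrM -mulrDr gtr0_norm//.
  by rewrite -/(row_size _ _) rL mulr1.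
by rewrite !rs.
Qed.

Lemma wmax_bl_lin i : wmax (bl_lin S i) <= ratio_max.
Proof.
have [_ [h1 h2]] := monomial_bl_lin i; rewrite /wmax h1 h2.
exact: (le_bigmax _ (fun i => Num.max (bl_a S i) (bl_b S i))).
Qed.

Lemma wmin_bl_lin i : ratio_min <= wmin (bl_lin S i).
Proof.
have [_ [h1 h2]] := monomial_bl_lin i; rewrite /wmin h1 h2.
exact: (bigmin_le _ _ (fun i => Num.min (bl_a S i) (bl_b S i))).
Qed.

Definition word_lin w : 'M[R]_2 := \prod_(i <- w) bl_lin S i.
Definition word_map w x : 'cV[R]_2 := foldr (fun i => bl_map S i) x w.
(** The singular values of the linear part of a word. *)
Definition alpha1 w := wmax (word_lin w).
Definition alpha2 w := wmin (word_lin w).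

Lemma word_lin_cat u v : word_lin (u ++ v) = word_lin u *m word_lin v.
Proof. by rewrite /word_lin big_cat. Qed.

Lemma word_lin1 i : word_lin [:: i] = bl_lin S i.
Proof. by rewrite /word_lin big_seq1. Qed.

Lemma word_lin0 : word_lin [::] = 1%:M.
Proof. by rewrite /word_lin big_nil. Qed.

Lemma monomial_word w : monomial (word_lin w).
Proof.
elim: w => [|i w IH]; first by rewrite word_lin0; have [] := monomial_scalar1 R.
rewrite -cat1s word_lin_cat word_lin1.
by have [] := monomial_mulmx (monomial_bl_lin i).1 IH.
Qed.

Lemma alpha1_nil : alpha1 [::] = 1.
Proof.
by rewrite /alpha1 word_lin0 /wmax !(monomial_scalar1 R).2 maxxx.
Qed.

Lemma alpha2_nil : alpha2 [::] = 1.
Proof.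
by rewrite /alpha2 word_lin0 /wmin !(monomial_scalar1 R).2 minxx.
Qed.

Lemma alpha2_le_alpha1 w : alpha2 w <= alpha1 w.
Proof. exact: wmin_le_wmax. Qed.

Lemma alpha2_rcons_ge w i : alpha2 w * ratio_min <= alpha2 (rcons w i).
Proof.
rewrite -cats1 /alpha2 word_lin_cat word_lin1.
apply: le_trans (wmin_mulmx (monomial_word w) (monomial_bl_lin i).1).
by rewrite ler_wpM2l ?wmin_ge0 ?wmin_bl_lin.
Qed.

Lemma alpha1_rcons_ge w i : alpha1 w * ratio_min <= alpha1 (rcons w i).
Proof.
rewrite -cats1 /alpha1 word_lin_cat word_lin1.
apply: le_trans (wmax_mulmx_ge (monomial_word w) (monomial_bl_lin i).1).
by rewrite ler_wpM2l ?wmax_ge0 ?wmin_bl_lin.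
Qed.

Lemma alpha2_gt0 w : 0 < alpha2 w.
Proof.
elim/last_ind: w => [|w i IH]; first by rewrite alpha2_nil.
by apply: lt_le_trans (alpha2_rcons_ge w i); rewrite mulr_gt0 ?ratio_min_gt0.
Qed.

Lemma alpha1_gt0 w : 0 < alpha1 w.
Proof. exact: lt_le_trans (alpha2_gt0 w) (alpha2_le_alpha1 w). Qed.

Lemma alpha1_cat u v : alpha1 (u ++ v) <= alpha1 u * alpha1 v.
Proof. by rewrite /alpha1 word_lin_cat wmax_mulmx//; exact: monomial_word. Qed.

Lemma alpha12_cat u v : alpha1 (u ++ v) * alpha2 (u ++ v) =
  (alpha1 u * alpha2 u) * (alpha1 v * alpha2 v).
Proof.
by rewrite /alpha1 /alpha2 word_lin_cat wmax_wmin_mulmx//; exact: monomial_word.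
Qed.

Lemma alpha1_le w : alpha1 w <= ratio_max ^+ size w.
Proof.
elim: w => [|i w IH]; first by rewrite alpha1_nil.
rewrite -cat1s (le_trans (alpha1_cat _ _))// exprS ler_pM ?wmax_ge0//.
by rewrite /alpha1 word_lin1 wmax_bl_lin.
Qed.

Lemma alpha1_le1 w : alpha1 w <= 1.
Proof.
apply: (le_trans (alpha1_le w)); rewrite exprn_ile1 ?ltW ?ratio_max_gt0//.
exact: ratio_max_lt1.
Qed.

Lemma alpha1_small (e : R) : 0 < e ->
  exists N, forall w, (N <= size w)%N -> alpha1 w <= e.
Proof.
move=> e0.
have := @cvg_expr R ratio_max.
rewrite ger0_norm ?ltW ?ratio_max_gt0// => /(_ ratio_max_lt1) /cvgr_lt /(_ e e0).
move=> [N _ hN]; exists N => w Nw; apply: (le_trans (alpha1_le w)).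
by apply/ltW/(hN (size w)).
Qed.

Definition phi s w := sv_fun s (word_lin w).

Lemma phiE s w : 1 <= s -> phi s w =
  if s <= 2 then alpha1 w * alpha2 w `^ (s - 1)
  else (alpha1 w * alpha2 w) `^ (s / 2).
Proof.
have mw := monomial_word w.
move=> s1; rewrite /phi /sv_fun sing1_monomial ?sing2_monomial//.
have -> : s == 0 = false by apply/negP => /eqP; lra.
rewrite -/(alpha1 w) -/(alpha2 w); case: ifP => // s1'.
have -> : s = 1 by lra.
rewrite subrr powRr0 mulr1 powRr1; last exact/ltW/alpha1_gt0.
by rewrite ifT//; lra.
Qed.

Lemma phi_ge0 s w : 0 <= phi s w.
Proof.
rewrite /phi /sv_fun.
by case: ifP => // _; case: ifP => _; rewrite ?powR_ge0//;
  case: ifP => _; rewrite ?mulr_ge0 ?powR_ge0 ?sqrtr_ge0.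
Qed.

(** For 1 <= s <= 2, phi^s is the product of the multiplicative
    (alpha1 alpha2)^(s-1) and the submultiplicative alpha1^(2-s). *)
Lemma phi_submul s u v : 1 <= s -> phi s (u ++ v) <= phi s u * phi s v.
Proof.
move=> s1; rewrite !phiE//; have a0 := alpha1_gt0; have b0 := alpha2_gt0.
case: ifP => s2; last first.
  by rewrite alpha12_cat powRM// mulr_ge0// ltW.
have E w : alpha1 w * alpha2 w `^ (s - 1) =
    (alpha1 w * alpha2 w) `^ (s - 1) * alpha1 w `^ (2 - s).
  rewrite powRM ?ltW// mulrAC -(powRD (x := alpha1 w)); last first.
    by apply/implyP => _; rewrite gt_eqF.
  by rewrite (_ : s - 1 + (2 - s) = 1) ?powRr1 ?ltW//; ring.
have a0' w : 0 <= alpha1 w by exact: ltW.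
have b0' w : 0 <= alpha2 w by exact: ltW.
rewrite !E alpha12_cat powRM ?mulr_ge0// mulrACA.
rewrite ler_wpM2l ?mulr_ge0 ?powR_ge0// -powRM//.
by apply: ge0_ler_powR; rewrite ?nnegrE ?mulr_ge0 ?alpha1_cat//; lra.
Qed.

(** An equality for s <= 2. For s > 2 the factor alpha1^(s/2) is at most
    alpha1; the exponent 1 + s/2 exceeds 2, and this is all that is needed to
    exclude an affinity dimension above 2. *)
Lemma phi_le s w : 1 <= s ->
  phi s w <= alpha1 w * alpha2 w `^ (Num.min s (1 + s / 2) - 1).
Proof.
move=> s1; rewrite phiE//; have a0 := alpha1_gt0 w; have b0 := alpha2_gt0 w.
case: ifP => s2.
  by rewrite (_ : Num.min s _ = s)//; apply/min_idPl; lra.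
have -> : Num.min s (1 + s / 2) = 1 + s / 2 by apply/min_idPr; lra.
rewrite addrAC subrr add0r powRM; [|exact: ltW..].
rewrite ler_wpM2r ?powR_ge0//.
by apply: ge1r_powR; [rewrite a0 alpha1_le1|lra].
Qed.

Lemma word_map_cat u v x : word_map (u ++ v) x = word_map u (word_map v x).
Proof. by rewrite /word_map foldr_cat. Qed.

Lemma word_mapB w x y : word_map w x - word_map w y = word_lin w *m (x - y).
Proof.
elim: w => [|i w IH]; first by rewrite word_lin0 mul1mx.
rewrite -cat1s word_lin_cat word_lin1 -mulmxA -IH /= /bl_map.
by rewrite mulmxBr opprD addrACA subrr addr0.
Qed.

Lemma euclid_dist_word_map w x y :
  alpha2 w * euclid_dist x y <= euclid_dist (word_map w x) (word_map w y)
    <= alpha1 w * euclid_dist x y.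
Proof. by rewrite /euclid_dist word_mapB euclid_mulmx//; exact: monomial_word. Qed.

End words_of_maps.

(** * Cylinders of the attractor under the rectangular open set condition *)

Section monomial_geometry.
Variable R : realType.
Implicit Types (A : 'M[R]_2) (u v z : 'cV[R]_2).

Lemma monomial_surj A z : monomial A -> 0 < wmin A -> exists v, A *m v = z.
Proof.
move=> mA m0; have rs i : 0 < row_size A i.
  by apply: (lt_le_trans m0); exact: row_size_ge.
have := rs 0; have := rs 1; rewrite /row_size.
case: mA => -[h1 h2]; rewrite h1 h2 normr0 ?addr0 ?add0r !normr_gt0 => a1 a0.
  exists (\col_i (z i 0 / A i i)); apply/matrixP => i j; rewrite ord1 {j}.
  move: i; apply: ord2P; rewrite mulmx2E ?h1 ?h2 !mxE mul0r ?addr0 ?add0r.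
    by rewrite mulrCA divff// mulr1.
  by rewrite mulrCA divff// mulr1.
exists (\col_i (z (i + 1) 0 / A (i + 1) i)); apply/matrixP => i j; rewrite ord1 {j}.
move: i; apply: ord2P; rewrite mulmx2E ?h1 ?h2 !mxE mul0r ?addr0 ?add0r ?ord2_add11.
  by rewrite mulrCA divff// mulr1.
by rewrite mulrCA divff// mulr1.
Qed.

Lemma wmax_coord A : monomial A ->
  exists j, forall v, wmax A * `|v j 0| <= euclid (A *m v).
Proof.
move=> mA; have [i ri] : exists i, row_size A i = wmax A.
  by rewrite /wmax; case: leP => _; [exists 1|exists 0].
have [h|h] := monomial_mulmx_vec mA; [exists i|exists (i + 1)] => v;
  by rewrite -ri -h coord_le_euclid.
Qed.

(** The point x is moved towards c by at most k, so that a whole interval of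
    half-length k around z fits inside. *)
Lemma interval_inner (x c E k : R) : 0 < k <= E -> `|x - c| <= E ->
  exists2 z, `|z - x| <= k & forall y, `|y - z| < k -> `|y - c| < E.
Proof.
move=> /andP[k0 kE] /ler_normlP[h1 h2].
have [h|h] := leP x (c + (E - k)); last first.
  exists (c + (E - k)); first by apply/ler_normlP; split; lra.
  by move=> y /ltr_normlP[? ?]; apply/ltr_normlP; split; lra.
have [h'|h'] := leP (c - (E - k)) x; last first.
  exists (c - (E - k)); first by apply/ler_normlP; split; lra.
  by move=> y /ltr_normlP[? ?]; apply/ltr_normlP; split; lra.
exists x; first by rewrite subrr normr0 ltW.
by move=> y /ltr_normlP[? ?]; apply/ltr_normlP; split; lra.
Qed.

Lemma truncn_eq_dist (x y k : R) : 0 < k -> 0 <= x -> 0 <= y ->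
  Num.truncn (x / k) = Num.truncn (y / k) -> `|x - y| < k.
Proof.
move=> k0 x0 y0 e.
have xk : 0 <= x / k by apply: divr_ge0 => //; exact: ltW.
have yk : 0 <= y / k by apply: divr_ge0 => //; exact: ltW.
have /andP[x1 x2] := truncn_itv xk; have /andP[y1 y2] := truncn_itv yk.
rewrite e in x1 x2; set n := Num.truncn _ in x1 x2 y1 y2.
rewrite ler_pdivlMr// in x1; rewrite ler_pdivlMr// in y1.
rewrite ltr_pdivrMr// in x2; rewrite ltr_pdivrMr// in y2.
rewrite -natr1 mulrDl mul1r in x2 y2.
by apply/ltr_normlP; split; lra.
Qed.

End monomial_geometry.

Lemma coord_le_mx_norm (R : realType) (v : 'cV[R]_2) i : `|v i 0| <= `|v|.
Proof.
by rewrite [leRHS]mx_normrE; apply: (le_bigmax _ (fun ij => `|v ij.1 ij.2|) (i, 0)).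
Qed.

Section attractor.
Variables (R : realType) (I : finType) (S : boxlike_ifs R I).
Variable F : set 'cV[R]_2.
Hypothesis attrF : is_attractor S F.
Implicit Types (u v w : seq I) (x y z : 'cV[R]_2) (s : R).
Local Notation word_map := (word_map S).
Local Notation alpha1 := (alpha1 S).
Local Notation alpha2 := (alpha2 S).

Lemma attractor_bounded : exists2 M : R, 0 < M &
  forall x, F x -> forall i, `|x i 0| <= M.
Proof.
have [_ /compact_bounded[M [_ hM]] _] := attrF.
exists (`|M| + 1); first by rewrite ltr_wpDl.
move=> x Fx i; apply: le_trans (coord_le_mx_norm x i) (hM (`|M| + 1) _ x Fx).
by rewrite (le_lt_trans (ler_norm M))// ltrDl.
Qed.

Lemma attractor_dist : exists2 B : R, 0 < B &
  forall x y, F x -> F y -> euclid_dist x y <= B.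
Proof.
have [M M0 hM] := attractor_bounded; exists (2 * (2 * M)); first by lra.
move=> x y Fx Fy; apply: euclid_le_coord => i; rewrite !mxE.
apply: (le_trans (ler_normB _ _)).
by have := hM x Fx i; have := hM y Fy i; lra.
Qed.

Lemma bl_map_attractor i x : F x -> F (bl_map S i x).
Proof.
by have [_ _ FE] := attrF => Fx; rewrite FE; exists i => //; exists x.
Qed.

Lemma word_map_attractor w x : F x -> F (word_map w x).
Proof. by move=> Fx; elim: w => //= i w; exact: bl_map_attractor. Qed.

Lemma word_map_rcons w x : F x ->
  exists i, exists2 y, F y & word_map w x = word_map (rcons w i) y.
Proof.
have [_ _ FE] := attrF; rewrite {1}FE => -[i _ [y Fy <-]].
by exists i, y => //; rewrite -cats1 word_map_cat.
Qed.

Lemma attractor_cut stop n w x : F x ->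
  exists2 u, u \in word_cut stop n w & exists2 y, F y & word_map w x = word_map u y.
Proof.
elim: n w x => [|n IH] w x Fx /=; first by exists w; [rewrite inE|exists x].
case: ifP => _; first by exists w; [rewrite inE|exists x].
have [i [y Fy ->]] := word_map_rcons w Fx.
have [u ui hu] := IH (rcons w i) y Fy; exists u => //.
by apply/flatten_mapP; exists i; rewrite ?mem_enum.
Qed.

Lemma attractor_deep n w x : F x ->
  exists v, (n <= size v)%N /\ exists2 y, F y & word_map w x = word_map (w ++ v) y.
Proof.
move=> Fx; elim: n => [|n [v [nv [y Fy ->]]]].
  by exists [::]; split=> //; exists x; rewrite ?cats0.
have [i [z Fz ->]] := word_map_rcons (w ++ v) Fy.
by exists (rcons v i); rewrite size_rcons; split=> //; exists z; rewrite -?rcons_cat.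
Qed.

Section open_rectangle.
Variables (m : 'cV[R]_2) (e : 'I_2 -> R).
Definition centred_rect : set 'cV[R]_2 := [set y | forall i, `|y i 0 - m i 0| < e i].
Hypothesis e_gt0 : forall i, 0 < e i.
Hypothesis rect_stable : forall i y, centred_rect y -> centred_rect (bl_map S i y).
Hypothesis rect_disjoint : forall i j y z, centred_rect y -> centred_rect z ->
  bl_map S i y = bl_map S j z -> i = j.

Lemma word_map_rect w y : centred_rect y -> centred_rect (word_map w y).
Proof. by move=> ry; elim: w => //= i w; exact: rect_stable. Qed.

Lemma word_map_inj w : injective (word_map w).
Proof.
move=> y z yz; have /andP[h _] := euclid_dist_word_map S w y z.
rewrite yz euclid_distxx pmulr_rle0 ?alpha2_gt0// in h.
apply/matrixP => i j; rewrite ord1 {j}; apply/eqP; rewrite -subr_eq0 -normr_eq0.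
have := coord_le_euclid (y - z) i; rewrite !mxE => h'.
by rewrite eq_le normr_ge0 (le_trans h').
Qed.

Lemma word_map_rect_disjoint u v y z : ~~ prefix u v -> ~~ prefix v u ->
  centred_rect y -> centred_rect z -> word_map u y != word_map v z.
Proof.
elim: u v => [|i u IH] [|j v]//= + + ry rz.
have [<- uv vu|ij _ _] := eqVneq i j.
  apply/eqP => /(@word_map_inj [:: i]) /eqP.
  exact/negP/IH.
apply/eqP => /rect_disjoint ij'; move/eqP: ij; apply.
by apply: ij'; exact: word_map_rect.
Qed.

(** Every point of F is, up to a contraction that can be made as strong as
    desired, the image of the centre m, which stays in the open rectangle. *)
Lemma attractor_sub_rect y : F y -> forall i, `|y i 0 - m i 0| <= e i.
Proof.
move=> Fy i; apply/ler_addgt0Pr => eps eps0.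
have rm : centred_rect m by move=> j; rewrite subrr normr0.
have [B B0 hB] := attractor_dist.
pose D := B + euclid_dist y m.
have D0 : 0 < D by rewrite ltr_wpDr// euclid_ge0.
have [N hN] := alpha1_small S (divr_gt0 eps0 D0).
have [v [Nv [z Fz]]] := attractor_deep N [::] Fy; rewrite cat0s => yE.
have zm : euclid_dist z m <= D.
  by apply: (le_trans (euclid_dist_triangle z y m)); rewrite lerD2r hB.
have /andP[_ h] := euclid_dist_word_map S v z m.
have h1 : alpha1 v * euclid_dist z m <= eps.
  have := hN v Nv; rewrite ler_pdivlMr//; apply: le_trans.
  by rewrite ler_wpM2l// ltW// alpha1_gt0.
have := coord_le_euclid (word_map v z - word_map v m) i.
rewrite !mxE => h2.
have h3 : `|word_map v m i 0 - m i 0| < e i by apply: word_map_rect rm i.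
have := ler_normD (word_map v z i 0 - word_map v m i 0) (word_map v m i 0 - m i 0).
rewrite addrA subrK => h4; rewrite /= in yE; rewrite yE.
by have := le_trans (le_trans h2 h) h1; lra.
Qed.

(** The image of the rectangle is again an axis-parallel rectangle because the
    linear part is monomial; E gives its half-sides. *)
Lemma word_map_rect_box w : exists E : 'I_2 -> R,
  [/\ forall i, Num.min (e 0) (e 1) * alpha2 w <= E i,
      forall y, (forall i, `|y i 0 - m i 0| <= e i) ->
        forall i, `|word_map w y i 0 - word_map w m i 0| <= E i &
      forall z, (forall i, `|z i 0 - word_map w m i 0| < E i) ->
        exists2 y, centred_rect y & word_map w y = z].
Proof.
have mw := monomial_word S w.
have el i : Num.min (e 0) (e 1) <= e i.
  by move: i; apply: ord2P; rewrite ge_min lexx ?orbT.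
have em0 : 0 < Num.min (e 0) (e 1) by rewrite lt_min !e_gt0.
have rs i : alpha2 w <= row_size (word_lin S w) i by exact: row_size_ge.
have rs0 i : 0 < row_size (word_lin S w) i.
  by apply: lt_le_trans (rs i); exact: alpha2_gt0.
have i11 (i : 'I_2) : i + 1 + 1 = i by rewrite -addrA ord2_add11 addr0.
have sub y i : word_map w y i 0 - word_map w m i 0 = (word_lin S w *m (y - m)) i 0.
  by rewrite -word_mapB !mxE.
have sub0 y i : y i 0 - m i 0 = (y - m) i 0 by rewrite !mxE.
have inv z : exists y, word_map w y = z.
  have [v vE] := monomial_surj (z - word_map w m) mw (alpha2_gt0 S w).
  exists (m + v); apply/eqP; rewrite -subr_eq0 -(subrKA (word_map w m)) word_mapB.
  by rewrite (_ : m + v - m = v) ?vE ?subrKA ?subrr// addrC addKr.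
have bd i j : Num.min (e 0) (e 1) * alpha2 w <= row_size (word_lin S w) i * e j.
  by rewrite mulrC ler_pM// ltW// alpha2_gt0.
have [h|h] := monomial_mulmx_vec mw.
  exists (fun i => row_size (word_lin S w) i * e i); split=> // [y hy i|z hz].
    by rewrite sub h -sub0 ler_pM2l.
  have [y yz] := inv z; exists y => // i.
  by have := hz i; rewrite -yz sub h -sub0 ltr_pM2l.
exists (fun i => row_size (word_lin S w) i * e (i + 1)); split=> // [y hy i|z hz].
  by rewrite sub h -sub0 ler_pM2l.
have [y yz] := inv z; exists y => // i.
by have := hz (i + 1); rewrite -yz sub h -sub0 ltr_pM2l// i11.
Qed.

(** Number of cells per side of the grid used in [rect_packing_le]; it depends
    neither on the scale nor on the words. *)
Definition grid_size : nat :=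
  (Num.truncn (2 + 2 / (Num.min (e 0) (e 1) * ratio_min S))).+1.

(** The cylinders of C sit in disjoint rectangles with sides of order at least
    delta. Each contains a square of half-side k, of order delta, centred
    near U; the squares are disjoint, so their centres fall in different
    cells of a grid of mesh k. *)
Lemma rect_packing_le delta (U : set 'cV[R]_2) (C : seq (seq I)) : 0 < delta ->
  (forall x y, U x -> U y -> euclid_dist x y <= delta) ->
  uniq C ->
  (forall w, w \in C -> ratio_min S * delta <= alpha2 w) ->
  (forall u v, u \in C -> v \in C -> u != v -> ~~ prefix u v) ->
  (forall w, w \in C -> exists2 y, F y & U (word_map w y)) ->
  (size C <= grid_size * grid_size)%N.
Proof.
move=> d0 dU uC hC anti meet.
have [->//|[w0 w0C]] : C = [::] \/ exists w0, w0 \in C.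
  by case: C {uC hC anti meet} => [|w0 C]; [left|right; exists w0; rewrite mem_head].
have [p Up] : exists p, U p by have [y _ Uy] := meet w0 w0C; exists (word_map w0 y).
set em := Num.min (e 0) (e 1).
have em0 : 0 < em by rewrite lt_min !e_gt0.
pose k := em * (ratio_min S * delta).
have k0 : 0 < k by rewrite !mulr_gt0 ?ratio_min_gt0.
have /choice[z zP] : forall w, exists z : 'cV[R]_2, w \in C ->
    (forall i, `|z i 0 - p i 0| <= k + delta) /\
    (forall y, (forall i, `|y i 0 - z i 0| < k) ->
       exists2 y', centred_rect y' & word_map w y' = y).
  move=> w; have [wC|_] := boolP (w \in C); last by exists 0.
  have [y Fy Uy] := meet w wC; have [E [Ege Ele Ein]] := word_map_rect_box w.
  have kE i : 0 < k <= E i.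
    by rewrite k0/= (le_trans _ (Ege i))// ler_pM2l// hC.
  have /choice[t tP] : forall i, exists t, `|t - word_map w y i 0| <= k /\
      forall r : R, `|r - t| < k -> `|r - word_map w m i 0| < E i.
    move=> i; have [t ? ?] := interval_inner (kE i) (Ele y (attractor_sub_rect Fy) i).
    by exists t.
  exists (\col_i t i) => _; split=> [i|y' hy'].
    have := ler_normD (t i - word_map w y i 0) (word_map w y i 0 - p i 0).
    rewrite addrA subrK mxE => /le_trans; apply; apply: lerD; first by have [] := tP i.
    apply: le_trans (dU _ _ Uy Up); have := coord_le_euclid (word_map w y - p) i.
    by rewrite !mxE.
  apply: Ein => i; have [_] := tP i; apply; by have := hy' i; rewrite mxE.
(* The cell of the centre z w, in a grid whose origin is p shifted by
   k + delta so that all coordinates are nonnegative. *)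
pose g w i : nat := Num.truncn ((z w i 0 - p i 0 + (k + delta)) / k).
have nn w i : w \in C -> 0 <= z w i 0 - p i 0 + (k + delta) <= 2 * (k + delta).
  by move=> /zP[/(_ i) /ler_normlP[? ?] _]; apply/andP; split; lra.
have gK w i : w \in C -> (g w i < grid_size)%N.
  move=> wC; have /andP[n1 n2] := nn w i wC; rewrite /grid_size ltnS.
  apply: le_truncn.
  have -> : 2 + 2 / (em * ratio_min S) = 2 * (k + delta) / k.
    rewrite /k; have := ratio_min_gt0 S; move: em0 d0.
    by move=> ? ? ?; field; apply/andP; split; rewrite ?mulf_neq0 ?gt_eqF.
  by rewrite ler_pM2r ?invr_gt0.
pose G w : 'I_grid_size * 'I_grid_size := (inord (g w 0), inord (g w 1)).
have uG : uniq (map G C).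
  rewrite map_inj_in_uniq// => u v uinC vinC [].
  move=> /(congr1 val) + /(congr1 val); rewrite /= !inordK ?gK// => g0 g1.
  apply/eqP; apply: contraT => uv.
  have cl i : `|z v i 0 - z u i 0| < k.
    have /andP[nu _] := nn u i uinC; have /andP[nv _] := nn v i vinC.
    have gi : g v i = g u i by move: i {nu nv}; apply: ord2P.
    have := truncn_eq_dist k0 nv nu gi.
    by rewrite (_ : _ - _ = z v i 0 - z u i 0)//; ring.
  have [_ /(_ (z v) cl)[y ry yE]] := zP u uinC.
  have [_ /(_ (z v))[i|y' ry' yE']] := zP v vinC.
    by rewrite subrr normr0.
  have := word_map_rect_disjoint (anti _ _ uinC vinC uv) _ ry ry'.
  by rewrite yE yE' eqxx => /(_ (anti _ _ vinC uinC _)); apply; rewrite eq_sym.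
have := uniq_leq_size uG (s2 := enum {: 'I_grid_size * 'I_grid_size}).
rewrite size_map -cardT card_prod card_ord; apply => x _.
by rewrite mem_enum.
Qed.

(** Double counting of the pairs formed by a cylinder and a set of the cover
    that meets it: the sets meeting a cylinder cover it, and each set meets
    boundedly many cylinders. *)
Lemma cover_double_count delta n (C : seq (seq I)) (b : seq I -> R) : 0 < delta ->
  uniq C ->
  (forall w, w \in C -> ratio_min S * delta <= alpha2 w) ->
  (forall u v, u \in C -> v \in C -> u != v -> ~~ prefix u v) ->
  (forall w k, w \in C ->
     coverable (@euclid_dist R) (word_map w @` F) delta k -> b w <= k%:R) ->
  coverable (@euclid_dist R) F delta n ->
  \sum_(w <- C) b w <= (grid_size * grid_size)%:R * n%:R.
Proof.
move=> d0 uC hC anti hb [U [dU FU]].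
pose J w := [set j : 'I_n | `[< exists2 y, F y & U j (word_map w y) >] ]%SET.
apply: (@le_trans _ _ (\sum_(w <- C) \sum_(j < n) (j \in J w)%:R)).
  rewrite big_seq [leRHS]big_seq; apply: ler_sum => w wC.
  rewrite -natr_sum.
  have -> : (\sum_(j < n) (j \in J w))%N = #|J w|.
    by rewrite -sum1_card [RHS]big_mkcond/=; apply: eq_bigr => j _; case: ifP.
  apply: hb => //.
  exists (fun j => U (enum_val j)); split=> [j x y|]; first exact: dU.
  move=> _ [y Fy <-]; have [j _ Uj] := FU _ (word_map_attractor w Fy).
  have jJ : j \in J w by rewrite inE; apply/asboolP; exists y.
  by exists (enum_rank_in jJ j) => //; rewrite enum_rankK_in.
rewrite exchange_big/= mulr_natr -[X in _ *+ X](card_ord n) -sumr_const.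
apply: ler_sum => j _; rewrite -natr_sum ler_nat.
have -> : (\sum_(w <- C) (j \in J w))%N = size [seq w <- C | j \in J w].
  rewrite size_filter -sum1_count [RHS]big_mkcond/=.
  by apply: eq_bigr => w _; case: ifP.
apply: (@rect_packing_le delta (U j)) => //.
- exact: dU.
- exact: filter_uniq.
- by move=> w; rewrite mem_filter => /andP[_]; exact: hC.
- by move=> u v; rewrite !mem_filter => /andP[_ ?] /andP[_ ?]; exact: anti.
- by move=> w; rewrite mem_filter inE => /andP[/asboolP].
Qed.

End open_rectangle.

(** The projection of the cylinder of w to its long side is a copy, scaled by
    alpha1 w, of one of the two projections of F. *)
Lemma coverable_cylinder_proj w delta k :
  exists j, coverable (@euclid_dist R) (word_map w @` F) delta k ->
    coverable (@line_dist R) [set y j 0 | y in F] (delta / alpha1 w) k.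
Proof.
have [j hj] := wmax_coord (monomial_word S w); exists j => -[U [dU FU]].
exists (fun i => [set t | exists2 y, F y & t = y j 0 /\ U i (word_map w y)]); split.
  move=> i _ _ [y Fy [-> Uy]] [z Fz [-> Uz]].
  rewrite ler_pdivlMr ?alpha1_gt0// mulrC; apply: le_trans (dU i _ _ Uy Uz).
  by have := hj (y - z); rewrite -word_mapB !mxE.
move=> _ [y Fy <-].
have [i _ Ui] : (\bigcup_i U i) (word_map w y) by apply: FU; exists y.
by exists i => //=; exists y.
Qed.

End attractor.

(** * The upper bound for the upper box dimension *)

Section covers.
Variable R : realType.

Lemma coverableU (T : Type) (dist : T -> T -> R) (E1 E2 : set T) delta n1 n2 :
  coverable dist E1 delta n1 -> coverable dist E2 delta n2 ->
  coverable dist (E1 `|` E2) delta (n1 + n2).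
Proof.
move=> [U1 [d1 c1]] [U2 [d2 c2]].
exists (fun i => match fintype.split i with inl j => U1 j | inr j => U2 j end).
split=> [i x y|x].
  by case: fintype.split => j; [exact: d1|exact: d2].
case=> [/c1[j _ Uj]|/c2[j _ Uj]].
  exists (lshift n2 j) => //.
  by rewrite (_ : fintype.split _ = inl j)//; apply: (unsplitK (inl j)).
exists (rshift n1 j) => //.
by rewrite (_ : fintype.split _ = inr j)//; apply: (unsplitK (inr j)).
Qed.

Lemma coverable_sub (T : Type) (dist : T -> T -> R) (E1 E2 : set T) delta n :
  E1 `<=` E2 -> coverable dist E2 delta n -> coverable dist E1 delta n.
Proof. by move=> E12 [U [dU cU]]; exists U; split=> // x /E12/cU. Qed.

Lemma coverable_seq (A : eqType) (T : Type) (dist : T -> T -> R) (E : A -> set T)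
    delta (C : seq A) (b : A -> R) :
  (forall a, a \in C -> exists2 k, coverable dist (E a) delta k & k%:R <= b a) ->
  exists2 n, coverable dist [set x | exists2 a, a \in C & E a x] delta n &
    n%:R <= \sum_(a <- C) b a.
Proof.
elim: C => [|a C IH] h.
  exists 0; last by rewrite big_nil.
  by exists (fun _ => set0); split=> [i x y []|x /= [a]].
have [|n cn nb] := IH; first by move=> a' aC; apply: h; rewrite inE aC orbT.
have [k ck kb] := h a (mem_head _ _).
exists (k + n)%N; last by rewrite big_cons natrD lerD.
apply: coverable_sub (coverableU ck cn) => x /= [a' ].
by rewrite inE => /orP[/eqP->|]; [left|right; exists a'].
Qed.

(** A grid of cells of side delta / 2, each of diameter at most delta. *)
Lemma coverable_box (E : set 'cV[R]_2) (p : 'I_2 -> R) delta : 0 < delta ->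
  (forall i, 0 <= p i) ->
  (forall x y i, E x -> E y -> `|x i 0 - y i 0| <= p i) ->
  exists2 n, coverable (@euclid_dist R) E delta n &
    n%:R <= (4 * p 0 / delta + 1) * (4 * p 1 / delta + 1).
Proof.
move=> d0 p0 hE.
have pd i : 0 <= 4 * p i / delta by rewrite divr_ge0 ?mulr_ge0// ltW.
have [E0|[ o Eo]] : E = set0 \/ exists o, E o.
  by have [-> | /set0P] := eqVneq E set0; [left|right].
  exists 0; last by rewrite mulr_ge0// addr_ge0.
  by rewrite E0; exists (fun _ => set0); split=> [i x y []|x []].
pose N i := (Num.truncn (4 * p i / delta)).+1.
pose g i (x : 'cV[R]_2) := Num.truncn ((x i 0 - o i 0 + p i) / (delta / 2)).
have nn i x : E x -> 0 <= x i 0 - o i 0 + p i <= 2 * p i.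
  by move=> Ex; have /ler_normlP[? ?] := hE x o i Ex Eo; apply/andP; split; lra.
have gN i x : E x -> (g i x < N i)%N.
  move=> Ex; have /andP[n1 n2] := nn i x Ex; rewrite /N ltnS; apply: le_truncn.
  have -> : 4 * p i / delta = 2 * p i / (delta / 2) by field; rewrite gt_eqF.
  by rewrite ler_pM2r// invr_gt0; lra.
exists #|{: 'I_(N 0) * 'I_(N 1)}|; last first.
  have Nle i : (N i)%:R <= 4 * p i / delta + 1.
    by rewrite /N -natr1 lerD2r truncn_le.
  by rewrite card_prod !card_ord natrM; apply: ler_pM.
exists (fun k : 'I_#|{: 'I_(N 0) * 'I_(N 1)}| => [set x | E x /\
  (g 0 x = (enum_val k).1 :> nat /\ g 1 x = (enum_val k).2 :> nat)]).
split=> [k x y [Ex [x0 x1]] [Ey [y0 y1]]|x Ex].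
  rewrite (_ : delta = 2 * (delta / 2)); last by field.
  apply: euclid_le_coord => i; rewrite !mxE.
  have /andP[xi _] := nn i x Ex; have /andP[yi _] := nn i y Ey.
  have gi : g i x = g i y by move: i {xi yi}; apply: ord2P; rewrite ?x0 ?x1 ?y0 ?y1.
  have d2 : 0 < delta / 2 by lra.
  have := truncn_eq_dist d2 xi yi gi.
  by rewrite (_ : _ - _ = x i 0 - y i 0) => [/ltW|]; last by ring.
exists (enum_rank (Ordinal (gN 0 x Ex), Ordinal (gN 1 x Ex))) => //=.
by rewrite enum_rankK.
Qed.

End covers.

Section upper_bound.
Variables (R : realType) (I : finType) (S : boxlike_ifs R I).
Variable F : set 'cV[R]_2.
Hypothesis attrF : is_attractor S F.
Implicit Types (u v w : seq I) (s delta : R).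
Local Notation word_map := (word_map S).
Local Notation alpha1 := (alpha1 S).
Local Notation alpha2 := (alpha2 S).
Local Notation phi := (phi S).

Lemma cylinder_cover : exists2 B : R, 0 < B & forall w delta, 0 < delta ->
  exists2 k, coverable (@euclid_dist R) (word_map w @` F) delta k &
    k%:R <= (B * alpha1 w / delta + 1) * (B * alpha2 w / delta + 1).
Proof.
have [B B0 hB] := attractor_dist attrF; exists (4 * B); first by rewrite mulr_gt0.
move=> w delta d0.
have [|x y i|k ck kb] := @coverable_box R (word_map w @` F)
    (fun i => row_size (word_lin S w) i * B) delta d0.
- by move=> i; rewrite mulr_ge0 ?row_size_ge0// ltW.
- move=> [x' Fx <-] [y' Fy <-].
  have /matrixP/(_ i 0) := word_mapB S w x' y'.
  rewrite [LHS]mxE [X in _ + X]mxE => ->.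
  have cB j : `|(x' - y') j 0| <= B.
    by apply: (le_trans (coord_le_euclid _ _)); exact: hB.
  by have [h|h] := monomial_mulmx_vec (monomial_word S w);
    rewrite h ler_wpM2l ?row_size_ge0.
exists k => //; apply: (le_trans kb).
have E r : 4 * (r * B) / delta = 4 * B * r / delta by ring.
by rewrite !E -(wmax_wmin_fun (fun r => 4 * B * r / delta + 1)).
Qed.

(** When g first drops below delta it does so by a bounded factor. Used for g
    either singular value. *)
Lemma cut_lower (g : seq I -> R) delta n w : 0 <= delta <= 1 -> g [::] = 1 ->
  (forall w i, g w * ratio_min S <= g (rcons w i)) ->
  w \in word_cut (fun u => g u <= delta) n [::] -> ratio_min S * delta <= g w.
Proof.
move=> /andP[d0 d1] g0 gS /mem_cut[v -> [_ nst]]; rewrite cat0s.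
have c1 := ratio_min_le1 S; have c0 := ratio_min_gt0 S.
case/lastP: v nst => [|v i] nst; first by rewrite g0; nra.
have := nst v [:: i]; rewrite cats1 -ltNge cat0s => /(_ erefl isT) => gv.
by apply: le_trans (gS v i); nra.
Qed.

Section summable_exponent.
Variables (s Z : R).
Hypothesis Z_bound : forall K, \sum_(0 <= k < K) word_sum k (phi s) <= Z.

Lemma cut_phi_le stop n : \sum_(u <- word_cut stop n [::]) phi s u <= Z.
Proof.
apply: le_trans (Z_bound n.+1); rewrite big_mkord.
apply: (le_trans (cut_sum_le _ _ _ (@phi_ge0 _ _ S s))).
by apply: ler_sum => m _; apply: ler_sum => v _; rewrite cat0s.
Qed.

Lemma cut_cover g delta N (b : seq I -> R) :
  (forall w, w \in word_cut (fun u => g u <= delta) N [::] ->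
    exists2 k, coverable (@euclid_dist R) (word_map w @` F) delta k & k%:R <= b w) ->
  exists2 n, coverable (@euclid_dist R) F delta n &
    n%:R <= \sum_(w <- word_cut (fun u => g u <= delta) N [::]) b w.
Proof.
move=> /coverable_seq[n cn nb]; exists n => //.
apply: coverable_sub cn => x Fx /=.
have [u uC [y Fy /= xy]] := attractor_cut attrF (fun u => g u <= delta) N [::] Fx.
by exists u => //; exists y.
Qed.

(** Cutting where alpha2 reaches delta, a cylinder is covered by a constant
    times alpha1 / delta sets, and this is delta^-s phi^s up to a constant. *)
Lemma cover_le_of_summable_ge1 : 1 <= s <= 2 ->
  exists2 c, 0 < c & forall delta, 0 < delta < 1 ->
    exists2 n, coverable (@euclid_dist R) F delta n & n%:R <= c * delta `^ (- s).
Proof.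
move=> /andP[s1 s2]; have [B B0 hB] := cylinder_cover.
set c0 := ratio_min S; have c00 : 0 < c0 := ratio_min_gt0 S.
pose D := (B + c0^-1) * (B + 1) * c0 `^ (1 - s).
have D0 : 0 < D by rewrite !mulr_gt0 ?powR_gt0 ?addr_gt0 ?invr_gt0.
exists (D * (`|Z| + 1)); first by rewrite mulr_gt0// ltr_wpDl.
move=> delta /andP[d0 d1].
have [N hN] := alpha1_small S d0.
pose C := word_cut (fun u => alpha2 u <= delta) N [::].
have Cst u : u \in C -> alpha2 u <= delta.
  apply: (@cut_stop I (fun u => alpha2 u <= delta) N [::] N) => // w Nw.
  exact: le_trans (alpha2_le_alpha1 S w) (hN w Nw).
have Clow u : u \in C -> c0 * delta <= alpha2 u.
  apply: cut_lower; [by rewrite !ltW|exact: alpha2_nil|exact: alpha2_rcons_ge].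
have [w wC|n cn nb] := cut_cover (g := alpha2) (delta := delta) (N := N)
    (b := fun w => D * delta `^ (- s) * phi s w).
  have [k ck kb] := hB w _ d0; exists k => //; apply: (le_trans kb).
  have a2d := Cst w wC; have da2 := Clow w wC; have a21 := alpha2_le_alpha1 S w.
  have a20 := alpha2_gt0 S w; have a10 := alpha1_gt0 S w.
  have h2 : B * alpha2 w / delta + 1 <= B + 1.
    by rewrite lerD2r ler_pdivrMr// ler_pM2l.
  have h1 : B * alpha1 w / delta + 1 <= (B + c0^-1) * (alpha1 w / delta).
    rewrite mulrDl mulrA lerD2l ler_pdivlMl// mulr1 ler_pdivlMr//.
    exact: le_trans da2 a21.
  apply: (@le_trans _ _ ((B + c0^-1) * (alpha1 w / delta) * (B + 1))).
    by apply: ler_pM => //; rewrite addr_ge0// divr_ge0 ?mulr_ge0// ltW.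
  have -> : D * delta `^ (- s) * phi s w =
      (B + c0^-1) * alpha1 w * (B + 1) *
      (c0 `^ (1 - s) * delta `^ (- s) * alpha2 w `^ (s - 1)).
    by rewrite phiE// s2 /D; ring.
  have -> : (B + c0^-1) * (alpha1 w / delta) * (B + 1) =
    (B + c0^-1) * alpha1 w * (B + 1) * delta^-1 by ring.
  rewrite ler_wpM2l; first by []; first by rewrite !mulr_ge0 ?addr_ge0 ?invr_ge0// ltW.
  have -> : delta^-1 = c0 `^ (1 - s) * delta `^ (- s) * (c0 * delta) `^ (s - 1).
    rewrite powRM ?ltW//.
    have pp (x : R) : 0 < x -> x `^ (1 - s) * x `^ (s - 1) = 1.
      move=> x0; rewrite -powRD; last by apply/implyP => _; rewrite gt_eqF.
      by rewrite (_ : _ + _ = 0) ?powRr0//; ring.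
    have -> : delta `^ (- s) = delta^-1 * delta `^ (1 - s).
      rewrite -(powR_inv1 (ltW d0)) -powRD; last by apply/implyP => _; rewrite gt_eqF.
      by congr (_ `^ _); ring.
    have := pp _ c00; have := pp _ d0 => ed ec.
    rewrite [RHS](_ : _ = delta^-1 * (c0 `^ (1 - s) * c0 `^ (s - 1)) *
      (delta `^ (1 - s) * delta `^ (s - 1))); last by ring.
    by rewrite ed ec !mulr1.
  rewrite ler_wpM2l ?mulr_ge0 ?powR_ge0//.
  by apply: ge0_ler_powR; rewrite ?nnegrE ?mulr_ge0//; lra.
exists n => //; apply: (le_trans nb); rewrite -mulr_sumr.
rewrite [leRHS]mulrAC ler_wpM2l//; first by rewrite mulr_ge0 ?powR_ge0// ltW.
apply: (le_trans (cut_phi_le _ N)); apply: (le_trans (ler_norm Z)).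
by rewrite lerDl.
Qed.

(** Cutting where alpha1 reaches delta, a cylinder is covered by a bounded
    number of sets, and 1 is delta^-s phi^s up to a constant. *)
Lemma cover_le_of_summable_le1 : 0 <= s <= 1 ->
  exists2 c, 0 < c & forall delta, 0 < delta < 1 ->
    exists2 n, coverable (@euclid_dist R) F delta n & n%:R <= c * delta `^ (- s).
Proof.
move=> /andP[s0 s1]; have [B B0 hB] := cylinder_cover.
have c00 := ratio_min_gt0 S.
pose D := (B + 1) * (B + 1) * (ratio_min S) `^ (- s).
have D0 : 0 < D by rewrite !mulr_gt0 ?powR_gt0 ?addr_gt0.
exists (D * (`|Z| + 1)); first by rewrite mulr_gt0// ltr_wpDl.
move=> delta /andP[d0 d1].
have [N hN] := alpha1_small S d0.
pose C := word_cut (fun u => alpha1 u <= delta) N [::].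
have Cst u : u \in C -> alpha1 u <= delta.
  by apply: (@cut_stop I (fun u => alpha1 u <= delta) N [::] N).
have Clow u : u \in C -> ratio_min S * delta <= alpha1 u.
  apply: cut_lower; [by rewrite !ltW|exact: alpha1_nil|exact: alpha1_rcons_ge].
have phiE1 w : phi s w = alpha1 w `^ s.
  rewrite /phi /sv_fun sing1_monomial; last exact: monomial_word.
  by case: eqP => [->|_]; rewrite ?powRr0// s1.
have [w wC|n cn nb] := cut_cover (g := alpha1) (delta := delta) (N := N)
    (b := fun w => D * delta `^ (- s) * phi s w).
  have [k ck kb] := hB w _ d0; exists k => //; apply: (le_trans kb).
  have a1d := Cst w wC; have da1 := Clow w wC; have a21 := alpha2_le_alpha1 S w.
  have a20 := alpha2_gt0 S w; have a10 := alpha1_gt0 S w.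
  have h x : x <= delta -> B * x / delta + 1 <= B + 1.
    by move=> xd; rewrite lerD2r ler_pdivrMr// ler_pM2l.
  apply: (@le_trans _ _ ((B + 1) * (B + 1))).
    by apply: ler_pM; rewrite ?h ?(le_trans a21)// addr_ge0// divr_ge0 ?mulr_ge0// ltW.
  rewrite /D -!mulrA ler_wpM2l ?addr_ge0 ?(ltW B0)//.
  rewrite ler_peMr ?addr_ge0 ?(ltW B0)// mulrA -powRM ?(ltW c00) ?(ltW d0)//.
  have cd0 : 0 < ratio_min S * delta by rewrite mulr_gt0.
  rewrite powRN mulrC ler_pdivlMr ?powR_gt0// mul1r phiE1.
  by apply: ge0_ler_powR; rewrite ?nnegrE ?(ltW a10) ?(ltW cd0).
exists n => //; apply: (le_trans nb); rewrite -mulr_sumr.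
rewrite [leRHS]mulrAC ler_wpM2l//; first by rewrite mulr_ge0 ?powR_ge0// ltW.
apply: (le_trans (cut_phi_le _ N)); apply: (le_trans (ler_norm Z)).
by rewrite lerDl.
Qed.

End summable_exponent.

Lemma upper_box_dim_le2 : (upper_box_dim (@euclid_dist R) F <= 2%:E)%E.
Proof.
have [B B0 hB] := cylinder_cover.
apply: (@upper_box_dim_le _ _ _ _ _ ((B + 1) * (B + 1)) 1) => //.
  by rewrite mulr_gt0 ?addr_gt0.
move=> delta /andP[d0 d1]; have [k ck kb] := hB [::] delta d0.
exists k; first by rewrite [X in coverable _ X](_ : _ = word_map [::] @` F)//= image_id.
apply: (le_trans kb); rewrite alpha1_nil alpha2_nil mulr1.
have -> : delta `^ (- 2) = delta^-1 * delta^-1.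
  by rewrite (powR_invn 2 (ltW d0)) expr2 invfM.
rewrite mulrACA; have h : B / delta + 1 <= (B + 1) / delta.
  by rewrite mulrDl lerD2l mul1r invf_ge1// ltW.
by apply: ler_pM => //; rewrite addr_ge0// divr_ge0// ltW.
Qed.

(** Beyond s = 2 the trivial bound by the dimension of the plane is enough. *)
Lemma upper_box_dim_le_affinity :
  (upper_box_dim (@euclid_dist R) F <= affinity_dim S)%E.
Proof.
apply/ereal_infP => _ [s [s0 sfin] <-].
have [s2|s2] := leP s 2; last first.
  by apply: (le_trans upper_box_dim_le2); rewrite lee_fin ltW.
set Phi := fun k => word_sum k (phi s).
have Phi0 k : 0 <= Phi k by apply: word_sum_ge0 => w; exact: phi_ge0.
have tot0 : (0 <= \sum_(1 <= k <oo) (Phi k)%:E)%E.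
  by apply: nneseries_ge0 => k _ _; rewrite lee_fin.
have hZ K : \sum_(0 <= k < K) Phi k <= Phi 0 + fine (\sum_(1 <= k <oo) (Phi k)%:E)%E.
  case: K => [|K]; first by rewrite big_geq// addr_ge0// fine_ge0.
  rewrite big_nat_recl// lerD2l -(big_add1 _ _ 0 K.+1 predT) -lee_fin fineK; last first.
    by rewrite ge0_fin_numE.
  rewrite -sumEFin; apply: nneseries_lim_ge => k _ _; by rewrite lee_fin.
have [s1|s1] := leP s 1.
  have [|c c0 hc] := @cover_le_of_summable_le1 s _ hZ; first by rewrite s0.
  exact: upper_box_dim_le hc.
have [|c c0 hc] := @cover_le_of_summable_ge1 s _ hZ; first by rewrite ltW.
exact: upper_box_dim_le hc.
Qed.

End upper_bound.

(** * The lower bound for the lower box dimension *)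

Section lower_bound.
Variables (R : realType) (I : finType) (S : boxlike_ifs R I).
Variable F : set 'cV[R]_2.
Hypothesis attrF : is_attractor S F.
Implicit Types (u v w : seq I) (s t delta : R).
Local Notation word_map := (word_map S).
Local Notation alpha1 := (alpha1 S).
Local Notation alpha2 := (alpha2 S).
Local Notation phi := (phi S).
Local Notation proj j := [set y j 0 | y in F].

Hypothesis proj_dim : forall j : 'I_2,
  (1 <= lower_box_dim (@line_dist R) (proj j))%E.

(** Uniform in eta: the dimension gives the bound for small eta, and for the
    other eta a single set of the cover is enough once c is small. *)
Lemma proj_cover_ge t : 0 <= t < 1 -> exists2 c, 0 < c &
  forall j eta n, 0 < eta -> coverable (@line_dist R) (proj j) eta n ->
    c * eta `^ (- t) <= n%:R.
Proof.
move=> /andP[t0 t1].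
have hj j : exists2 d, 0 < d & forall eta, 0 < eta < d ->
    forall n, coverable (@line_dist R) (proj j) eta n -> eta `^ (- t) <= n%:R.
  by apply: lower_box_dim_gt; apply: lt_le_trans (proj_dim j); rewrite lte_fin.
have [e0 e00 h0] := hj 0; have [e1 e10 h1] := hj 1.
pose e := Num.min 1 (Num.min e0 e1).
have egt : 0 < e by rewrite !lt_min ltr01 e00.
have ele : [/\ e <= 1, e <= e0 & e <= e1] by rewrite /e !ge_min !lexx !orbT.
case: ele => ele1 ele0 elee1.
exists (e `^ t); first by rewrite powR_gt0.
move=> j eta n eta0 cn.
have [eeta|etae] := leP e eta.
  have n1 : (1 : R) <= n%:R.
    rewrite -[1]/(1%:R) ler_nat lt0n; apply/eqP => n0.
    have [[y Fy] _ _] := attrF; subst n; case: cn => U [_ /(_ (y j 0))].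
    by case=> [|[]]; first by exists y.
  apply: le_trans n1; rewrite powRN ler_pdivrMr ?powR_gt0// mul1r.
  by apply: ge0_ler_powR; rewrite ?nnegrE ?(ltW egt) ?(ltW eta0).
have : eta `^ (- t) <= n%:R.
  move: j cn; apply: ord2P => cn.
    by apply: h0 cn; rewrite eta0 (lt_le_trans etae).
  by apply: h1 cn; rewrite eta0 (lt_le_trans etae).
apply: le_trans; rewrite -[leRHS]mul1r ler_wpM2r ?powR_ge0//.
apply: (@le_trans _ _ (1 `^ t)); last by rewrite powR1.
by apply: ge0_ler_powR; rewrite ?nnegrE ?(ltW egt).
Qed.

Lemma lower_box_dim_ge1 : (1 <= lower_box_dim (@euclid_dist R) F)%E.
Proof.
apply/lee_addgt0Pr => e e0; rewrite -leeBlDr//.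
pose t := Num.max 0 (1 - e).
have t01 : 0 <= t < 1 by rewrite le_max lexx/= gt_max ltr01/=; lra.
apply: (@le_trans _ _ t%:E); first by rewrite -EFinB lee_fin le_max lexx orbT.
have [c c0 hc] := proj_cover_ge t01.
apply: (@lower_box_dim_ge _ _ _ _ t c 1) => // delta /andP[d0 d1] n cn.
have [j hj] := coverable_cylinder_proj S F [::] delta n.
have : coverable (@euclid_dist R) (word_map [::] @` F) delta n.
  by rewrite [X in coverable _ X](_ : _ = F)//= image_id.
by move=> /hj; rewrite alpha1_nil divr1; exact: hc.
Qed.

(** Otherwise the series would converge at s, which is below the infimum of
    such exponents. *)
Lemma cut_phi_ge1 stop N s : 1 <= s -> (s%:E < affinity_dim S)%E ->
  (forall u, u \in word_cut stop N [::] -> u != [::]) ->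
  1 <= \sum_(u <- word_cut stop N [::]) phi s u.
Proof.
move=> s1 sd ne; rewrite leNgt; apply/negP => h.
have [M hM] := summable_of_cut (@phi_ge0 _ _ S s) (fun u v => phi_submul S u v s1) ne h.
move: sd; rewrite ltNge => /negP; apply.
apply: ereal_inf_lbound; exists s => //; split; first lra.
apply: (@le_lt_trans _ _ M%:E); last by rewrite ltry.
have Phi0 k : 0 <= word_sum k (phi s) by apply: word_sum_ge0 => w; exact: phi_ge0.
apply: lime_le.
  by apply: is_cvg_nneseries => k _ _; rewrite lee_fin; exact: Phi0.
apply: nearW => -[|K].
  by rewrite big_geq ?lee_fin// (le_trans _ (hM 0))// big_geq.
rewrite sumEFin lee_fin; apply: le_trans (hM K.+1).
by rewrite [leRHS](@big_cat_nat _ _ _ 1)//= lerDr sumr_ge0.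
Qed.

Section rectangle.
Variables (m : 'cV[R]_2) (e : 'I_2 -> R).
Hypothesis e_gt0 : forall i, 0 < e i.
Hypothesis rect_stable : forall i y, centred_rect m e y ->
  centred_rect m e (bl_map S i y).
Hypothesis rect_disjoint : forall i j y z, centred_rect m e y ->
  centred_rect m e z -> bl_map S i y = bl_map S j z -> i = j.

(** In the cut at which alpha2 reaches delta, the long side of each cylinder
    needs at least (alpha1 / delta)^(1 - eps) sets, up to a constant, by the
    hypothesis on projections. Since alpha2 <= delta this is at least
    delta^-(s' - eps) phi^s, and the phi^s of the cut add up to at least 1.
    For s > 2 the exponent exceeds 2, which makes such s impossible. *)
Lemma lower_box_dim_ge_affinity s : 1 <= s -> (s%:E < affinity_dim S)%E ->
  ((Num.min s (1 + s / 2))%:E <= lower_box_dim (@euclid_dist R) F)%E.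
Proof.
move=> s1 sd; set s' := Num.min _ _.
have s'1 : 1 <= s' by rewrite le_min s1/=; lra.
apply/lee_addgt0Pr => eps' eps'0; rewrite -leeBlDr//.
(* The projections are used at the exponent 1 - eps, which must not be
   negative. *)
pose eps := Num.min eps' 1.
have eps0 : 0 < eps by rewrite lt_min eps'0 ltr01.
have epsle : eps <= eps' by rewrite ge_min lexx.
have eps1 : eps <= 1 by rewrite ge_min lexx orbT.
apply: (@le_trans _ _ (s' - eps)%:E); first by rewrite -EFinB lee_fin; lra.
have [|c c0 hc] := @proj_cover_ge (1 - eps); first by apply/andP; split; lra.
pose K : R := (grid_size S e * grid_size S e)%:R.
have K0 : 0 < K by rewrite /K ltr0n muln_gt0.
apply: (@lower_box_dim_ge _ _ _ _ _ (c / K) 1) => //; first by rewrite divr_gt0.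
move=> delta /andP[d0 d1] n cn.
have [N hN] := alpha1_small S d0.
set stop := fun u => alpha2 u <= delta.
pose C := word_cut stop N [::].
have Cst : {in C, forall u, stop u}.
  apply: (@cut_stop I stop N [::] N) => // w Nw.
  exact: le_trans (alpha2_le_alpha1 S w) (hN w Nw).
have Clow u : u \in C -> ratio_min S * delta <= alpha2 u.
  apply: cut_lower; [by rewrite !ltW|exact: alpha2_nil|exact: alpha2_rcons_ge].
have ne u : u \in C -> u != [::].
  by move=> /Cst; apply: contraTneq => ->; rewrite /stop alpha2_nil -ltNge.
have mass := cut_phi_ge1 s1 sd ne.
have anti u v : u \in C -> v \in C -> u != v -> ~~ prefix u v.
  exact: (cut_antichain Cst).
(* A cylinder contains a copy of a projection scaled by alpha1, to be covered
   by sets of diameter delta / alpha1. *)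
have := cover_double_count attrF e_gt0 rect_stable rect_disjoint
  (b := fun w => c * (delta / alpha1 w) `^ (- (1 - eps))) d0 (cut_uniq stop N [::])
  Clow anti _ cn.
have hb w k : w \in C -> coverable (@euclid_dist R) (word_map w @` F) delta k ->
    c * (delta / alpha1 w) `^ (- (1 - eps)) <= k%:R.
  move=> _; have [j hj] := coverable_cylinder_proj S F w delta k.
  by move=> /hj; apply: hc; rewrite divr_gt0// alpha1_gt0.
move=> /(_ hb); rewrite -/K => ub.
rewrite mulrAC ler_pdivrMr// mulrC (mulrC _ K); apply: le_trans ub.
rewrite mulrC -mulr_sumr ler_wpM2l ?(ltW c0)//.
apply: (@le_trans _ _ (\sum_(w <- C) delta `^ (- (s' - eps)) * phi s w)).
  by rewrite -mulr_sumr -[leLHS]mulr1 ler_wpM2l ?powR_ge0.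
rewrite big_seq [leRHS]big_seq; apply: ler_sum => w wC.
have a10 := alpha1_gt0 S w; have a11 := alpha1_le1 S w; have a20 := alpha2_gt0 S w.
have pD (x y : R) : delta `^ (x + y) = delta `^ x * delta `^ y.
  by rewrite powRD//; apply/implyP => _; rewrite gt_eqF.
apply: (@le_trans _ _ (delta `^ (- (s' - eps)) * (alpha1 w * delta `^ (s' - 1)))).
  rewrite ler_wpM2l ?powR_ge0//; apply: (le_trans (phi_le S w s1)).
  rewrite ler_wpM2l ?(ltW a10)//.
  by apply: ge0_ler_powR; rewrite ?nnegrE ?(ltW a20) ?(ltW d0) ?subr_ge0//; exact: Cst.
rewrite mulrCA -pD (_ : _ + _ = - (1 - eps)); last by ring.
rewrite powRM ?(ltW d0) ?invr_ge0 ?(ltW a10)// mulrC ler_wpM2l ?powR_ge0//.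
rewrite -powR_inv1 ?(ltW a10)// -powRrM mulN1r opprK.
by apply: ger1_powR; [rewrite a10|lra].
Qed.

End rectangle.
End lower_bound.

(** * The lower bound for the packing dimension *)

Section packing_lower_bound.
Variables (R : realType) (I : finType) (S : boxlike_ifs R I).
Variable F : set 'cV[R]_2.
Hypothesis attrF : is_attractor S F.
Implicit Types (u v w : seq I) (x y z : 'cV[R]_2) (s t delta : R).
Local Notation word_map := (word_map S).
Local Notation alpha1 := (alpha1 S).
Local Notation alpha2 := (alpha2 S).

Lemma attractor_cluster (p : nat -> 'cV[R]_2) : (forall n, F (p n)) ->
  exists2 q, F q & forall eps N, 0 < eps ->
    exists2 n, (N <= n)%N & euclid_dist (p n) q < eps.
Proof.
move=> Fp; have [_ cF _] := attrF.
have [|q [Fq clq]] := cF (p @ \oo) _; first by exists 0 => // n _; exact: Fp.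
exists q => // eps N eps0.
have [] := clq (p @` [set n | (N <= n)%N]) (ball q (eps / 4)).
- by exists N => // n /= Nn; exists n.
- by apply: nbhsx_ballx; rewrite divr_gt0.
move=> _ [[n /= Nn <-] qn]; exists n => //.
rewrite euclid_dist_sym; apply: (@le_lt_trans _ _ (2 * (eps / 4))); last by lra.
apply: euclid_le_coord => i; apply: le_trans (coord_le_mx_norm _ i) _.
by apply: ltW; move: qn; rewrite mx_norm_ball.
Qed.

(** The Baire category theorem on the tree of words: if no E n is dense in a
    cylinder, there are nested cylinders W 1, W 2, ... with that of W n.+1 at
    positive distance from E n, and a cluster point q of points chosen in
    them belongs to no E n. *)
Lemma attractor_baire (E : nat -> set 'cV[R]_2) : F `<=` \bigcup_n E n ->
  exists w n, forall y eps, (word_map w @` F) y -> 0 < eps ->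
    exists2 z, E n z & euclid_dist y z < eps.
Proof.
move=> FE; apply: contrapT => H.
have [B B0 hB] := attractor_dist attrF.
have step (wn : seq I * nat) : exists vr : seq I * R, 0 < vr.2 /\
    forall x z, F x -> E wn.2 z -> vr.2 <= euclid_dist (word_map (wn.1 ++ vr.1) x) z.
  case: wn => w n /=.
  have [y [eps [Fy eps0 far]]] : exists y eps,
      [/\ F y, 0 < eps & forall z, E n z -> eps <= euclid_dist (word_map w y) z].
    apply: contrapT => H'; apply: H; exists w, n => _ eps [y Fy <-] eps0.
    apply: contrapT => H2; apply: H'; exists y, eps; split=> // z Ez.
    by rewrite leNgt; apply/negP => lt; apply: H2; exists z.
  have eB0 : 0 < eps / 2 / B by rewrite !divr_gt0.
  have [N hN] := alpha1_small S eB0.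
  have [v [Nv [y' Fy' yE]]] := attractor_deep attrF N w Fy.
  exists (v, eps / 2) => /=; split=> [|x z Fx Ez]; first by rewrite divr_gt0.
  have := far z Ez; rewrite yE => h1.
  have h2 := euclid_dist_triangle (word_map (w ++ v) y') (word_map (w ++ v) x) z.
  have /andP[_ h3] := euclid_dist_word_map S (w ++ v) y' x.
  have h4 : alpha1 (w ++ v) * euclid_dist y' x <= eps / 2.
    have := hN (w ++ v); rewrite size_cat (leq_trans Nv (leq_addl _ _)) => /(_ isT).
    rewrite ler_pdivlMr//; apply: le_trans.
    by rewrite ler_wpM2l ?hB// ltW// alpha1_gt0.
  by have := le_trans h3 h4; lra.
have {step} /choice[f fP] := step.
(* W n.+1 is chosen so that its cylinder avoids E n. *)
pose W := fix W n := if n is n'.+1 then W n' ++ (f (W n', n')).1 else [::].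
have [[x0 Fx0] _ _] := attrF.
have Wext k n : (n <= k)%N -> exists v, W k = W n ++ v.
  elim: k => [|k IH]; first by rewrite leqn0 => /eqP->; exists [::].
  rewrite leq_eqVlt => /orP[/eqP->|]; first by exists [::]; rewrite cats0.
  by rewrite ltnS => /IH[v /= ->]; eexists; rewrite -catA.
have [q Fq clq] := attractor_cluster (fun n => word_map_attractor attrF (W n) Fx0).
have [n _ Enq] := FE q Fq.
have [r0 far] := fP (W n, n).
have [k nk] := clq _ n.+1 r0.
have [v ->] := Wext k n.+1 nk; rewrite word_map_cat ltNge => /negP; apply.
by apply: far => //; exact: word_map_attractor.
Qed.

Lemma coverable_cylinder_inv w delta n :
  coverable (@euclid_dist R) (word_map w @` F) delta n ->
  coverable (@euclid_dist R) F (delta / alpha2 w) n.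
Proof.
move=> [U [dU cU]]; exists (fun i => [set y | U i (word_map w y)]); split.
  move=> i x y /= Ux Uy; rewrite ler_pdivlMr ?alpha2_gt0// mulrC.
  by apply: le_trans (dU i _ _ Ux Uy); have /andP[] := euclid_dist_word_map S w x y.
by move=> y Fy; have [|i _ Ui] := cU (word_map w y); [exists y|exists i].
Qed.

(** One of the sets of a countable cover of small packing measure is dense in
    a cylinder, which it bounds the covering numbers of; and F is the image of
    the cylinder under an affine map. *)
Lemma upper_box_dim_le_of_packing_measure0 s : 0 <= s ->
  packing_measure (@euclid_dist R) s F = 0%E ->
  (upper_box_dim (@euclid_dist R) F <= s%:E)%E.
Proof.
move=> s0 P0.
have : (packing_measure (@euclid_dist R) s F < 1)%E by rewrite P0 lte01.
move=> /ereal_inf_ltP[_ [E FE <-] sum1].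
have pre0 k : (0 <= packing_premeasure (@euclid_dist R) s (E k))%E.
  exact: (packing_premeasure_ge0 _ (0 : 'cV[R]_2)).
have [w [n dense]] := attractor_baire FE.
have pre1 : (packing_premeasure (@euclid_dist R) s (E n) < 1)%E.
  apply: le_lt_trans sum1; apply: (@le_trans _ _ (\sum_(0 <= k < n.+1)
    packing_premeasure (@euclid_dist R) s (E k))%E).
    by rewrite big_nat_recr//= leeDr// sume_ge0.
  by apply: nneseries_lim_ge.
have [d0 d00 hd] := coverable_of_premeasure_lt (0 : 'cV[R]_2)
  (@euclid_distxx R) (@euclid_dist_sym R) (@euclid_dist_triangle R)
  (@euclid_diametral R) s0 pre1.
have a0 := alpha2_gt0 S w.
apply: (@upper_box_dim_le _ _ _ _ _ ((alpha2 w / 3) `^ (- s)) (d0 * 6 / alpha2 w)).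
- by rewrite powR_gt0// divr_gt0.
- by rewrite divr_gt0 ?mulr_gt0.
move=> eta /andP[e0 ed].
have [||k ck kb] := hd (eta * alpha2 w / 6) _ (word_map w @` F).
- rewrite divr_gt0 ?mulr_gt0//= ltr_pdivrMr// -ltr_pdivlMr//.
- by move=> y eps; exact: dense.
exists k.
  have -> : eta = 6 * (eta * alpha2 w / 6) / alpha2 w by field; rewrite gt_eqF.
  exact: coverable_cylinder_inv.
apply: (le_trans kb); rewrite -powRM ?(ltW e0) ?divr_ge0 ?(ltW a0)//.
by rewrite (_ : 2 * _ = alpha2 w / 3 * eta)//; field.
Qed.

End packing_lower_bound.

(** * The dimensions of the attractor *)

Theorem corollary2p5 (R : realType) (I : finType) (hI : (2 <= #|I|)%N)
  (S : boxlike_ifs R I) (F : set 'cV[R]_2)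
  (hF : is_attractor S F) (hrosc : ROSC S)
  (hs1 : box_dim_is (@line_dist R) (@pi1 R @` F) 1%E)
  (hs2 : box_dim_is (@line_dist R) (@pi2 R @` F) 1%E) :
  packing_dim (@euclid_dist R) F = affinity_dim S /\
  box_dim_is (@euclid_dist R) F (affinity_dim S).
Proof.
have proj_dim j : (1 <= lower_box_dim (@line_dist R) [set (y j 0)%R | y in F])%E.
  move: j; apply: ord2P.
    by rewrite -[X in lower_box_dim _ X]/(@pi1 R @` F) hs1.1.
  by rewrite -[X in lower_box_dim _ X]/(@pi2 R @` F) hs2.1.
have [a [b [c [d [ab cd stable disj]]]]] := hrosc.
pose m : 'cV[R]_2 := \col_i [:: (a + b) / 2; (c + d) / 2]`_i.
pose e (i : 'I_2) : R := [:: (b - a) / 2; (d - c) / 2]`_i.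
have rectE : open_rect a b c d = centred_rect m e.
  apply/seteqP; split=> y.
    move=> [/andP[y0 y0'] /andP[y1 y1']]; apply: ord2P; rewrite !mxE/= /e/=;
    by apply/ltr_normlP; rewrite /pi1 /pi2 in y0 y0' y1 y1'; split; lra.
  move=> h; have := h 0; have := h 1; rewrite !mxE/= /e/=.
  move=> /ltr_normlP[? ?] /ltr_normlP[? ?].
  by split; apply/andP; rewrite /pi1 /pi2; split; lra.
have e0 i : 0 < e i by move: i; apply: ord2P; rewrite /e/=; lra.
have rect_stable i y : centred_rect m e y -> centred_rect m e (bl_map S i y).
  by rewrite -rectE => ry; apply: (stable i); exists y.
have rect_disjoint i j y z : centred_rect m e y -> centred_rect m e z ->
    bl_map S i y = bl_map S j z -> i = j.
  rewrite -rectE => ry rz yz; apply: (disj i j) => //.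
  by exists (bl_map S i y); split; [exists y|exists z; rewrite ?yz].
have upper_le := upper_box_dim_le_affinity hF.
have lower_upper := lower_le_upper_box_dim (@euclid_dist R) F.
have upper2 := upper_box_dim_le2 hF.
have lower1 := lower_box_dim_ge1 hF proj_dim.
have lower_ge : (affinity_dim S <= lower_box_dim (@euclid_dist R) F)%E.
  rewrite leNgt; apply/negP => lt.
  have lfin : lower_box_dim (@euclid_dist R) F \is a fin_num.
    rewrite fin_numE; apply/andP; split.
      by apply/eqP => lE; rewrite lE in lower1.
    by apply/eqP => lE; have := le_trans lower_upper upper2; rewrite lE.
  move: lt lower1 (le_trans lower_upper upper2).
  rewrite -(fineK lfin); set l := fine _; rewrite !lee_fin => lt l1 l2.
  have [d' ld' hd'] : exists2 d', l < d' & (d'%:E <= affinity_dim S)%E.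
    move: lt; case: (affinity_dim S) => [r| |]; rewrite ?lte_fin//.
      by exists r.
    by exists (l + 1); rewrite ?ltrDl// leey.
  (* As l <= 2, both s and 1 + s / 2 exceed l. *)
  pose s := (l + d') / 2.
  have := lower_box_dim_ge_affinity hF proj_dim e0 rect_stable rect_disjoint (s := s).
  rewrite -(fineK lfin) lee_fin -/l ge_min /s => h.
  have /orP[|] : (s <= l) || (1 + s / 2 <= l).
    rewrite /s; apply: h; first lra.
    by apply: lt_le_trans hd'; rewrite lte_fin; lra.
  - by rewrite /s; lra.
  - by rewrite /s; lra.
have lowerE : lower_box_dim (@euclid_dist R) F = affinity_dim S.
  by apply/eqP; rewrite eq_le lower_ge (le_trans lower_upper).
have upperE : upper_box_dim (@euclid_dist R) F = affinity_dim S.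
  by apply/eqP; rewrite eq_le upper_le (le_trans lower_ge).
split; last by split.
apply/eqP; rewrite eq_le; apply/andP; split; last first.
  apply/ereal_infP => _ [s [s0 Ps] <-]; rewrite -upperE.
  exact: (upper_box_dim_le_of_packing_measure0 hF s0 Ps).
have Dfin : affinity_dim S \is a fin_num.
  rewrite fin_numE; apply/andP; split; apply/eqP => DE.
    by move: lower1; rewrite lowerE DE.
  by move: upper2; rewrite upperE DE.
apply/lee_addgt0Pr => eps eps0; rewrite -(fineK Dfin) -EFinD.
have D1 : 1 <= fine (affinity_dim S) by rewrite -lee_fin fineK// -lowerE.
apply: (packing_dim_le (0 : 'cV[R]_2) (@euclid_distxx R) (@euclid_dist_sym R)
  (@euclid_dist_triangle R) (t := fine (affinity_dim S) + eps / 2)); [lra|lra|].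
by rewrite upperE -{1}(fineK Dfin) lte_fin; lra.
Qed.
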